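(* Let $C$ be a smooth curve of genus $g$ and $P\in C$ a point with first (smallest positive) non-gap $a$, such that the first non-gap $b$ of $P$ that is not a multiple of $a$ is $b=na+r$ with $n\geq 1$, $0<r<a$; assume $\gcd(a,b)=1$, $\dim|(n+1)aP|=n+2$ and $g=(a-1)(b-a+r)/2$. Let $Q$ be a point on $C$ with $aQ\in|aP|$ and assume $Q$ corresponds to a cusp $\phi(Q)$ of type $(a-r;a)$ on the plane model $\Gamma$ of $C$. Then $\mathrm{WS}(Q)$ is equal to the union $S=\langle a;b\rangle\cup T$ of $\langle a;b\rangle$ and the set $T$ of trivial new non-gaps associated to a cusp of type $(a-r;a)$.
   Context: Curves are smooth, irreducible, projective, over $\mathbb{C}$. For a point $P\in C$, $\mathrm{WS}(P)=\{0\}\cup\{m\in\mathbb{N}: |mP| \text{ is base point free}\}$, and its elements are the non-gaps of $P$; $\langle a;b\rangle\subseteq\mathbb{N}$ is the semigroup generated by $a,b$. $|D|$ is the complete linear system of $D$ and $\dim|D|$ its projective dimension. Plane model: choose $D\in|bP|$ general and let $g^2_b\subseteq|bP|$ be the linear span of the pencil $(b-a)P+|aP|$ and $D$. This is a simple base point free net (since $\gcd(a,b)=1$), and the corresponding morphism $\phi:C\to\mathbb{P}^2$ is birational onto a plane curve $\Gamma$ of degree $b$, the plane model. Cusp: a point $x$ of an irreducible plane curve $\Gamma$ is a cusp if exactly one point of the normalisation maps to $x$. If $\nu$ is the multiplicity of $\Gamma$ at $x$, there is a unique line $L$ through $x$ whose intersection multiplicity $\mu'$ with $\Gamma$ at $x$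 satisfies $\mu'>\nu$; the cusp is then of type $(\nu;\mu')$ (the case $\nu=1$ is allowed). Trivial new non-gaps: set $\mu=a-r$ (so $\gcd(a,\mu)=1$). For each integer $1\leq m\leq\mu-1$ let $n(m)$ be the integer with $(n(m)-1)\mu<ma<n(m)\mu$ (then $n(m)<a$). Then $T=\{\,ib-ma : 1\leq m\leq\mu-1,\ n(m)\leq i\leq a-1\,\}$. *)

(* Defs.v *)
From HB Require Import structures.
From mathcomp Require Import all_boot all_order all_algebra.
From mathcomp Require Import boolp classical_sets reals complex.
From mathcomp Require Import freeg mpoly.

Set Implicit Arguments.
Unset Strict Implicit.
Unset Printing Implicit Defensive.

Import Order.TTheory GRing.Theory Num.Theory.
Local Open Scope ring_scope.
Local Open Scope classical_set_scope.

(* The field of complex numbers is R[i] for R : realType. *)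

(* A point of P^n(C) is represented by its unique vector of homogeneous
   coordinates whose first nonzero entry is 1. *)
Definition normalized (R : realType) (n : nat) : pred 'rV[R[i]]_n.+1 :=
  fun v => [exists i : 'I_n.+1, (v 0 i == 1) &&
             [forall j : 'I_n.+1, (j < i)%N ==> (v 0 j == 0)]].

Definition proj (R : realType) (n : nat) := {v : 'rV[R[i]]_n.+1 | normalized v}.

Definition crd (R : realType) (n : nat) (p : proj R n) : 'I_n.+1 -> R[i] :=
  fun i => val p 0 i.

Section Varieties.
Variables (R : realType) (K : fieldType) (iota : {rmorphism R[i] -> K}).

Definition evalK (n : nat) (x : 'I_n -> K) (F : {mpoly R[i][n]}) : K :=
  mmap iota x F.

Definition alg_indep (n : nat) (x : 'I_n -> K) : Prop :=
  forall F : {mpoly R[i][n]}, evalK x F = 0 -> F = 0.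

Definition has_trdeg (d : nat) : Prop :=
  (exists x : 'I_d -> K, alg_indep x) /\
  (forall x : 'I_d.+1 -> K, ~ alg_indep x).

Variables (n : nat) (x : 'I_n.+1 -> K).

(* The irreducible projective variety X in P^n(C) with generic point
   [x_0 : ... : x_n] in P^n(K): the homogeneous ideal of X is spanned by the
   forms F with F(x) = 0, and the function field of X is the field generated
   over C by the ratios of the x_i.  Every irreducible closed subset of P^n(C)
   arises in this way. *)
Definition on_variety (p : proj R n) : bool :=
  `[< forall (d : nat) (F : {mpoly R[i][n.+1]}),
        F \is d.-homog -> evalK x F = 0 -> F.@[crd p] = 0 >].

Definition is_function_field : Prop :=
  forall f : K, exists (d : nat) (F G : {mpoly R[i][n.+1]}),
    [/\ F \is d.-homog, G \is d.-homog, evalK x G != 0 &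
        f = evalK x F / evalK x G].

(* The local ring of X at p.  For p on X, G(p) != 0 implies G(x) != 0. *)
Definition local_ring (p : proj R n) (f : K) : Prop :=
  exists (d : nat) (F G : {mpoly R[i][n.+1]}),
    [/\ F \is d.-homog, G \is d.-homog, G.@[crd p] != 0 &
        f = evalK x F / evalK x G].

(* v is the normalized discrete valuation with valuation ring O; the value of
   v at 0 is irrelevant. *)
Definition is_dvr_valuation (O : K -> Prop) (v : K -> int) : Prop :=
  [/\ forall f g, f != 0 -> g != 0 -> v (f * g) = v f + v g,
      forall f g, f != 0 -> g != 0 -> f + g != 0 ->
        Order.min (v f) (v g) <= v (f + g),
      exists2 t, t != 0 & v t = 1 &
      forall f, f != 0 -> (O f <-> 0 <= v f)].

End Varieties.

(* A smooth irreducible projective curve over C, embedded in some P^n and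
   given by its generic point.  A one-dimensional local ring is regular iff it
   is a discrete valuation ring, so smoothness amounts to the existence of the
   valuations [ord p], which are uniquely determined by the local rings. *)
Record curve (R : realType) := Curve {
  function_field :> fieldType;
  cst : {rmorphism R[i] -> function_field};
  adim : nat;
  gen : 'I_adim.+1 -> function_field;
  gen_neq0 : exists i, gen i != 0;
  gen_function_field : is_function_field cst gen;
  trdeg1 : has_trdeg cst 1;
  ord : {p : proj R adim | on_variety cst gen p} -> function_field -> int;
  smooth : forall p : {p : proj R adim | on_variety cst gen p},
    is_dvr_valuation (local_ring cst gen (val p)) (ord p)
}.

Definition cpoint (R : realType) (X : curve R) :=
  {p : proj R (adim X) | on_variety (cst X) (gen (c := X)) p}.

Definition divisor (R : realType) (X : curve R) := {freeg (cpoint X) / int}.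

Definition mpt (R : realType) (X : curve R) (m : nat) (p : cpoint X) :
  divisor X := << m%:Z *g p >>.

Section LinearSystems.
Variables (R : realType) (X : curve R).
Implicit Types (D E : divisor X) (V : X -> Prop).

(* E = D + div f *)
Definition differ_by_div D E (f : X) : Prop :=
  f != 0 /\ forall p : cpoint X, coeff p E = coeff p D + ord p f.

Definition effective D : Prop := forall p : cpoint X, 0 <= coeff p D.

Definition complete_system D : set (divisor X) :=
  [set E | effective E /\ exists f : X, differ_by_div D E f].

(* L(D) *)
Definition rr_space D (f : X) : Prop :=
  f = 0 \/ forall p : cpoint X, 0 <= coeff p D + ord p f.

Definition is_basis V (l : nat) (e : 'I_l -> X) : Prop :=
  (forall f : X, V f <->
     exists c : 'I_l -> R[i], f = \sum_(i < l) cst X (c i) * e i) /\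
  (forall c : 'I_l -> R[i],
     \sum_(i < l) cst X (c i) * e i = 0 -> forall i, c i = 0).

Definition has_dim V (l : nat) : Prop := exists e : 'I_l -> X, is_basis V e.

(* |D| is the projective space of lines of L(D). *)
Definition has_dim_system D (d : nat) : Prop := has_dim (rr_space D) d.+1.

Definition base_point_free D : Prop :=
  forall p : cpoint X, exists2 E, complete_system D E & coeff p E = 0.

(* The genus is the least integer g such that l(D) >= deg D + 1 - g for every
   divisor D (as in Riemann's theorem). *)
Definition riemann_bound (g : nat) : Prop :=
  forall D, exists2 l : nat, has_dim (rr_space D) l & deg D + 1 - g%:Z <= l%:Z.

Definition has_genus (g : nat) : Prop :=
  riemann_bound g /\ forall g' : nat, riemann_bound g' -> (g <= g')%N.

Definition WS (p : cpoint X) : set nat :=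
  [set m | m = 0%N \/ base_point_free (mpt m p)].

(* f takes the value c at p *)
Definition has_value (p : cpoint X) (f : X) (c : R[i]) : Prop :=
  f = cst X c \/ 0 < ord p (f - cst X c).

(* The morphism [s_0 : ... : s_m] from X to P^m sends p to y. *)
Definition maps_to (m : nat) (s : 'I_m.+1 -> X) (p : cpoint X) (y : proj R m) :
  Prop :=
  exists2 t : X, t != 0 & forall i, has_value p (s i / t) (crd y i).

(* The subspace of L(bP) of the linear span, in |bP|, of the pencil
   (b-a)P + |aP| and D = bP + div h: a member (b-a)P + (aP + div f) of the
   pencil is bP + div f with f in L(aP). *)
Definition net_space (P : cpoint X) (a : nat) (h f : X) : Prop :=
  exists f0 : X, exists c : R[i], rr_space (mpt a P) f0 /\ f = f0 + cst X c * h.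

(* s gives projective coordinates for the morphism defined by the net spanned
   by (b-a)P + |aP| and D.  The generality of D in |bP| means that D lies in
   the open set of divisors not containing P, i.e. (when |aP| is base point
   free) that the net is base point free. *)
Definition plane_model (P : cpoint X) (a b : nat) (D : divisor X)
    (s : 'I_3 -> X) : Prop :=
  [/\ complete_system (mpt b P) D, coeff P D = 0 &
      exists2 h : X, differ_by_div (mpt b P) D h &
                     is_basis (net_space P a h) s].

(* F is an equation of the plane curve which is the image of [s_0:s_1:s_2]. *)
Definition plane_equation (s : 'I_3 -> X) (F : {mpoly R[i][3]}) : Prop :=
  (exists d : nat, F \is d.-homog) /\
  forall (d : nat) (G : {mpoly R[i][3]}), G \is d.-homog ->
    (evalK (cst X) s G = 0 <-> exists H : {mpoly R[i][3]}, G = H * F).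

End LinearSystems.

Section PlaneCurves.
Variables (R : realType) (F : {mpoly R[i][3]}).
Implicit Types (x u : proj R 2) (l : proj R 2).

Definition multiplicity x (nu : nat) : Prop :=
  (forall m : 'X_{1..3}, (mdeg m < nu)%N -> F^`M[m].@[crd x] = 0) /\
  (exists2 m : 'X_{1..3}, mdeg m = nu & F^`M[m].@[crd x] != 0).

(* l holds the coefficients of a linear form. *)
Definition on_line l x : Prop := \sum_i crd l i * crd x i = 0.

(* F(x + t u) as a polynomial in t *)
Definition restrict_line x u : {poly R[i]} :=
  mmap polyC (fun i => (crd x i)%:P + (crd u i) *: 'X) F.

(* The intersection multiplicity at x of the curve F with the line l through x
   is m: parametrize l by x + t u for another point u of l. *)
Definition line_multiplicity l x (m : nat) : Prop :=
  exists u, [/\ on_line l u, u != x, (restrict_line x u)`_m != 0 &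
                forall k, (k < m)%N -> (restrict_line x u)`_k = 0].

End PlaneCurves.

(* The plane curve F, image of X by [s_0:s_1:s_2], with normalization X, has a
   cusp of type (nu; mu) at x. *)
Definition is_cusp (R : realType) (X : curve R) (s : 'I_3 -> X)
    (F : {mpoly R[i][3]}) (x : proj R 2) (nu mu : nat) : Prop :=
  [/\ exists! q : cpoint X, maps_to s q x,
      multiplicity F x nu &
      exists l : proj R 2,
        [/\ on_line l x, line_multiplicity F l x mu, (nu < mu)%N &
            forall (l' : proj R 2) (m : nat), on_line l' x ->
              line_multiplicity F l' x m -> (nu < m)%N -> l' = l]].

Definition semigroup2 (a b : nat) : set nat :=
  [set k | exists i j : nat, k = (i * a + j * b)%N].

(* nm stands for n(m), and k = i b - m a. *)
Definition trivial_new_nongaps (a b mu : nat) : set nat :=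
  [set k | exists m i nm : nat,
     [/\ (1 <= m <= mu - 1)%N, ((nm - 1) * mu < m * a < nm * mu)%N,
         (nm <= i <= a - 1)%N & (k + m * a = i * b)%N]].

(* Main.v *)
(* The exact dimension l(D) = deg D + 1 - g for large degree follows from
   Riemann's inequality and the minimality of g, so every point has at least g
   gaps; by counting residues modulo a, the set S has exactly g gaps, hence it
   suffices to show that S is contained in WS(Q).  Let y have divisor aQ - aP,
   let h have a pole of order b at P, and z = h - h(Q).  Once k = ord_Q z is
   known to be mu = a - r, the functions (z / y^(n+1))^i y^m have poles of
   order ib - ma at Q only, which gives S.

   To prove k = mu, choose for each l < a a function f_l with a pole of order l
   at Q, no other pole than P, and least possible order at P.  Multiplication
   by z on the f_l is given by a matrix over C[y] whose characteristic
   polynomial G(Y, Z) is the equation of Gamma, has Newton polygon at the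
   origin above the segment from (0, a) to (k, 0), and contains Y^k; thus the
   multiplicity of Gamma at phi(Q) is min(a, k).

   If Q = P, the same argument with pole orders at P gives the multiplicity
   b - a, which forces a = 2, b = 3, r = 1 and T empty. *)
Require Import Defs.
From HB Require Import structures.
From mathcomp Require Import zify ring.
From mathcomp Require Import all_boot all_order all_algebra.
From mathcomp Require Import boolp classical_sets reals complex.
From mathcomp Require Import perm freeg mpoly.


Set Implicit Arguments.
Unset Strict Implicit.
Unset Printing Implicit Defensive.

Import Order.TTheory GRing.Theory Num.Theory.

(** * Discrete valuations *)

Section Valuation.
Local Open Scope ring_scope.
Variable K : fieldType.

(** Multiplicity is a property of the equation of Gamma, [k] a property of a function. They are
    linked through relations between [y] and [z]: since gcd(a, b) = 1, the products y^e z^i with i <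
    a have distinct orders at P, so no nonzero relation has degree below a in Z, and a relation
    monic of degree a in Z must be the equation up to a constant. The f_l form a basis over C[y] of
    the functions whose only poles are at P and, of order below a, at Q. The orders ae - l of the
    y^e f_l at Q are distinct, so orders at Q can be read off coefficients. The delicate point is
    the monomial Y^k. The Newton bound for z only shows that Y^k divides the constant term G_0 of G.
    Conversely, write G_0(y) = z w. The function w again has no pole outside P, so its matrix W
    satisfies the same kind of bound; W times the matrix of z is G_0 times the identity, and
    comparing determinants leaves no room for G_0(y) to vanish to order more than ak at Q. Finally
    min(a, k) = a - r is smaller than a, hence k = a - r. *)

Definition is_valuation (v : K -> int) : Prop :=
  (forall f g, f != 0 -> g != 0 -> v (f * g) = v f + v g) /\
  (forall f g, f != 0 -> g != 0 -> f + g != 0 ->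
     Order.min (v f) (v g) <= v (f + g)).

Variable v : K -> int.
Hypothesis val_v : is_valuation v.

(** The value of [v] at 0 is arbitrary. Here 0 gets infinite order, so that these sets are closed
    under addition without side conditions. *)
Definition vge (n : int) (f : K) : bool := (f == 0) || (n <= v f).

Lemma valM f g : f != 0 -> g != 0 -> v (f * g) = v f + v g.
Proof. by case: val_v => + _; apply. Qed.

Lemma val1 : v 1 = 0.
Proof.
have n1 : (1 : K) != 0 by apply: oner_neq0.
by have := valM n1 n1; rewrite mulr1; lia.
Qed.

Lemma valV f : f != 0 -> v f^-1 = - v f.
Proof.
move=> f0; have := valM f0 (invr_neq0 f0); rewrite mulfV // val1; lia.
Qed.

Lemma valN f : v (- f) = v f.
Proof.
have m1 : (-1 : K) != 0 by rewrite oppr_eq0 oner_neq0.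
have [->|f0] := eqVneq f 0; first by rewrite oppr0.
have := valM m1 m1; rewrite mulrNN mulr1 val1 => h.
by rewrite -mulN1r valM //; lia.
Qed.

Lemma valX f n : f != 0 -> v (f ^+ n) = v f *+ n.
Proof.
move=> f0; elim: n => [|n IH]; first by rewrite expr0 val1.
by rewrite exprS valM ?expf_neq0 // IH mulrS.
Qed.

Lemma vge0 n : vge n 0.
Proof. by rewrite /vge eqxx. Qed.

Lemma vge_neq0 n f : f != 0 -> vge n f = (n <= v f).
Proof. by move=> /negbTE f0; rewrite /vge f0. Qed.

Lemma vge_val f : vge (v f) f.
Proof. by rewrite /vge lexx orbT. Qed.

Lemma vge_le m n f : m <= n -> vge n f -> vge m f.
Proof.
by move=> mn /orP [f0|h]; apply/orP; [left | right; apply: le_trans h].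
Qed.

Lemma vgeD n f g : vge n f -> vge n g -> vge n (f + g).
Proof.
have [->|f0] := eqVneq f 0; first by rewrite add0r.
have [->|g0] := eqVneq g 0; first by rewrite addr0.
have [->|s0] := eqVneq (f + g) 0; first by rewrite vge0.
rewrite !vge_neq0 // => hf hg.
have [_ /(_ f g f0 g0 s0)] := val_v; apply: le_trans.
by rewrite le_min hf hg.
Qed.

Lemma vgeN n f : vge n (- f) = vge n f.
Proof. by rewrite /vge oppr_eq0 valN. Qed.

Lemma vgeB n f g : vge n f -> vge n g -> vge n (f - g).
Proof. by move=> hf hg; apply: vgeD; rewrite ?vgeN. Qed.

Lemma vge_sum (I : Type) (r : seq I) (p : pred I) n (F : I -> K) :
  (forall i, p i -> vge n (F i)) -> vge n (\sum_(i <- r | p i) F i).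
Proof.
by move=> h; elim/big_ind: _ => //; [exact: vge0 | exact: vgeD].
Qed.

Lemma vgeM m n f g : vge m f -> vge n g -> vge (m + n) (f * g).
Proof.
have [->|f0] := eqVneq f 0; first by rewrite mul0r !vge0.
have [->|g0] := eqVneq g 0; first by rewrite mulr0 !vge0.
by rewrite !vge_neq0 ?mulf_neq0 // valM //; apply: lerD.
Qed.

Lemma valD f g : f != 0 -> vge (v f + 1) g -> f + g != 0 /\ v (f + g) = v f.
Proof.
move=> f0 hg.
have ne : f + g != 0.
  apply/eqP => e; have fg : f = - g by apply/eqP; rewrite -addr_eq0 e.
  by move: hg; rewrite -vgeN -fg vge_neq0 //; lia.
split=> //; apply/eqP; rewrite eq_le; apply/andP; split; last first.
  by rewrite -vge_neq0 //; apply: vgeD; rewrite ?vge_val //; apply: vge_le hg; lia.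
rewrite leNgt; apply/negP => lt.
have : vge (v f + 1) f.
  rewrite -[X in vge _ X](addrK g); apply: vgeB => //.
  by rewrite vge_neq0 // lezD1.
by rewrite vge_neq0 // lezD1 ltxx.
Qed.

(** When the orders of the nonzero terms are distinct, the term of least order dominates all others
    strictly, so nothing cancels. Every independence statement below rests on this. *)
Lemma val_sum_neq (I : finType) (F : I -> K) (i0 : I) :
  F i0 != 0 ->
  (forall i j, F i != 0 -> F j != 0 -> v (F i) = v (F j) -> i = j) ->
  \sum_i F i != 0 /\
  exists2 i, F i != 0 & v (\sum_i F i) = v (F i) /\ forall j, vge (v (F i)) (F j).
Proof.
move=> Fi0 inj.
have [i Fi mini] : exists2 i, F i != 0 & forall j, vge (v (F i)) (F j).
  case: (arg_minP (P := fun i => F i != 0) (fun i => v (F i)) Fi0) => i Fi mini.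
  exists i => // j; have [->|Fj] := eqVneq (F j) 0; first exact: vge0.
  by rewrite vge_neq0 //; apply: mini.
have rest : vge (v (F i) + 1) (\sum_(j | j != i) F j).
  apply: vge_sum => j ji; have [->|Fj] := eqVneq (F j) 0; first exact: vge0.
  have := mini j; rewrite !vge_neq0 // lezD1 lt_neqAle => ->; rewrite andbT.
  by apply: contraNneq ji => /(inj _ _ Fi Fj) ->.
have [ne e] := valD Fi rest.
by rewrite (bigD1 i) //=; split=> //; exists i.
Qed.

Lemma val_sum_eq0 (I : finType) (F : I -> K) :
  (forall i j, F i != 0 -> F j != 0 -> v (F i) = v (F j) -> i = j) ->
  \sum_i F i = 0 -> forall i, F i = 0.
Proof.
move=> inj s0 i; apply/eqP; apply: contraT => Fi.
by have [] := val_sum_neq Fi inj; rewrite s0 eqxx.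
Qed.

End Valuation.

(** * Values and orders of functions on a curve *)

Section LinearIndependence.
Local Open Scope ring_scope.
Variables (F K : fieldType) (iota : {rmorphism F -> K}).

Definition lin_indep (n : nat) (e : 'I_n -> K) : Prop :=
  forall c : 'I_n -> F, \sum_i iota (c i) * e i = 0 -> forall i, c i = 0.

Lemma lin_indep_le (l n : nat) (e : 'I_l -> K) (w : 'I_n -> K) :
  (forall j, exists c : 'I_l -> F, w j = \sum_i iota (c i) * e i) ->
  lin_indep w -> (n <= l)%N.
Proof.
move=> span indep; rewrite leqNgt; apply/negP => lt.
have [c cE] := choice span.
pose A := \matrix_(j < n, i < l) c j i.
have : kermx A != 0.
  rewrite kermx_eq0 /row_free; apply/eqP => rk.
  by have := rank_leq_col A; rewrite rk leqNgt lt.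
case/rowV0Pn => u /sub_kermxP uA u0.
case/eqP: u0; apply/rowP => j; rewrite mxE.
apply: (indep (fun j => u 0 j)).
under eq_bigr => j' _ do rewrite cE mulr_sumr.
rewrite exchange_big big1 //= => i _.
under eq_bigr => j' _ do rewrite mulrA -rmorphM.
rewrite -mulr_suml -rmorph_sum.
have := congr1 (fun M : 'rV_l => M 0 i) uA; rewrite !mxE => uAi.
rewrite [X in iota X](_ : _ = 0) ?rmorph0 ?mul0r // -[RHS]uAi.
by apply: eq_bigr => j' _; rewrite mxE.
Qed.

End LinearIndependence.

Section EvalK.
Local Open Scope ring_scope.
Variables (R : realType) (K : fieldType) (iota : {rmorphism R[i] -> K}).
Variables (n : nat) (x : 'I_n -> K).
Implicit Types G H : {mpoly R[i][n]}.

Lemma evalKB G H : evalK iota x (G - H) = evalK iota x G - evalK iota x H.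
Proof. exact: mmapB. Qed.

Lemma evalKM G H : evalK iota x (G * H) = evalK iota x G * evalK iota x H.
Proof. exact: (rmorphM (mmap iota x)). Qed.

Lemma evalKZ c G : evalK iota x (c *: G) = iota c * evalK iota x G.
Proof. exact: mmapZ. Qed.

End EvalK.

Section CurveBasics.
Local Open Scope ring_scope.
Variables (R : realType) (X : curve R).
Implicit Types (p q : cpoint X) (D E : divisor X) (f : X).

Lemma ord_valuation p : is_valuation (@ord R X p).
Proof. by have [hM hD _ _] := smooth p. Qed.

Hint Resolve ord_valuation : core.

Lemma ord_local_ring p f : f != 0 ->
  (local_ring (cst X) (@gen R X) (val p) f <-> 0 <= ord p f).
Proof. by have [_ _ _] := smooth p; apply. Qed.

Lemma vge_cst p c : vge (@ord R X p) 0 (cst X c).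
Proof.
have [->|c0] := eqVneq (cst X c) 0; first exact: vge0.
rewrite vge_neq0 //; apply/ord_local_ring => //.
exists 0%N, c%:MP, 1; split.
- by rewrite -[c%:MP]mulr1 mul_mpolyC; apply/dhomogZ/dhomog1.
- exact: dhomog1.
- by rewrite meval1 oner_neq0.
- by rewrite /evalK mmapC rmorph1 divr1.
Qed.

Lemma ord_cst p c : c != 0 -> ord p (cst X c) = 0.
Proof.
move=> c0; have c0' : cst X c != 0 by rewrite fmorph_eq0.
have := vge_cst p c; have := vge_cst p c^-1.
rewrite fmorphV !vge_neq0 ?invr_neq0 // valV // oppr_ge0 => h1 h2.
by apply/eqP; rewrite eq_le h1 h2.
Qed.

Lemma vge_scale p n c f : vge (ord p) n f -> vge (ord p) n (cst X c * f).
Proof. by move=> /(vgeM (ord_valuation p) (vge_cst p c)); rewrite add0r. Qed.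

(** The residue field at [p] is C: for f = A/B take c = A(p)/B(p). If f - c = A1/B were a unit with
    inverse A2/B2, the form B B2 - A1 A2 would vanish on the curve, hence at [p], where A1 is zero
    but B and B2 are not. *)
Lemma vge_value p f : vge (ord p) 0 f -> exists c, vge (ord p) 1 (f - cst X c).
Proof.
have [->|f0] := eqVneq f 0.
  by move=> _; exists 0; rewrite rmorph0 subr0 vge0.
rewrite vge_neq0 // => /(ord_local_ring p f0) [d [A [B [hA hB B0 fE]]]].
have onp : forall (d' : nat) (G : {mpoly R[i][(adim X).+1]}),
    G \is d'.-homog -> evalK (cst X) (@gen R X) G = 0 -> G.@[crd (val p)] = 0.
  by case: p {f0 B0} => p /= /asboolP.
pose c := A.@[crd (val p)] / B.@[crd (val p)]; exists c.
have [->|g0] := eqVneq (f - cst X c) 0; first exact: vge0.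
pose A1 := A - c *: B.
have hA1 : A1 \is d.-homog by rewrite rpredB // dhomogZ.
have A1p : A1.@[crd (val p)] = 0.
  by rewrite mevalB mevalZ /c divfK // subrr.
have Bx : evalK (cst X) (@gen R X) B != 0.
  by apply/eqP => /(onp _ _ hB) e; rewrite e eqxx in B0.
have gE : f - cst X c = evalK (cst X) (@gen R X) A1 / evalK (cst X) (@gen R X) B.
  by rewrite fE evalKB evalKZ mulrBl mulfK.
have ge : 0 <= ord p (f - cst X c).
  by apply/ord_local_ring => //; exists d, A1, B.
rewrite vge_neq0 //; have [//|e] : 1 <= ord p (f - cst X c) \/ ord p (f - cst X c) = 0.
  by move: ge; case: (ord p _) => // -[|m] _; [right | left].
have : 0 <= ord p (f - cst X c)^-1 by rewrite valV // e.
case/(ord_local_ring p (invr_neq0 g0)) => d2 [A2 [B2 [hA2 hB2 B20 gE2]]].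
have B2x : evalK (cst X) (@gen R X) B2 != 0.
  by apply/eqP => /(onp _ _ hB2) e2; rewrite e2 eqxx in B20.
have A1x : evalK (cst X) (@gen R X) A1 != 0.
  by apply: contraNneq g0 => e1; rewrite gE e1 mul0r.
have hH : B * B2 - A1 * A2 \is (d + d2).-homog by rewrite rpredB // dhomogM.
have : evalK (cst X) (@gen R X) (B * B2 - A1 * A2) = 0.
  move: gE2; rewrite gE invf_div (evalKB _ _ (B * B2)) !evalKM => /eqP.
  by rewrite eqr_div // => /eqP ->; rewrite [X in _ - X]mulrC subrr.
move/(onp _ _ hH); rewrite mevalB !mevalM A1p mul0r subr0 => /eqP.
by rewrite mulf_eq0 (negbTE B0) (negbTE B20).
Qed.

(** One reduction step: a constant multiple of [h] cancels the leading term of [f]. *)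
Lemma vge_lead p n f h : vge (ord p) n f -> h != 0 -> ord p h = n ->
  exists c, vge (ord p) (n + 1) (f - cst X c * h).
Proof.
move=> fn h0 hn.
have : vge (ord p) 0 (f / h).
  rewrite -(subrr n); apply: vgeM => //.
  by rewrite vge_neq0 ?invr_neq0 // valV // hn.
case/vge_value => c hc; exists c.
have := vgeM (ord_valuation p) hc (vge_val (ord p) h).
by rewrite mulrBl divfK // hn addrC.
Qed.

Lemma rr_spaceP D f :
  rr_space D f <-> forall p, vge (ord p) (- coeff p D) f.
Proof.
split=> [[->|h] p|h]; first exact: vge0.
  by have := h p; rewrite /vge => h'; apply/orP; right; lia.
have [->|f0] := eqVneq f 0; [by left | right => p].
by have := h p; rewrite vge_neq0 //; lia.
Qed.

Lemma rr_spaceB D f h : rr_space D f -> rr_space D h -> rr_space D (f - h).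
Proof.
by rewrite !rr_spaceP => hf hh p; apply: vgeB.
Qed.

Lemma rr_space_scale D c f : rr_space D f -> rr_space D (cst X c * f).
Proof. by rewrite !rr_spaceP => hf p; apply: vge_scale. Qed.

Lemma rr_spaceM D E f h :
  rr_space D f -> rr_space E h -> rr_space (D + E) (f * h).
Proof.
by rewrite !rr_spaceP => hf hh p; rewrite coeffD opprD; apply: vgeM.
Qed.

Lemma rr_space_le D E f : (forall p, coeff p D <= coeff p E) ->
  rr_space D f -> rr_space E f.
Proof.
by rewrite !rr_spaceP => h hf p; apply: vge_le (hf p); rewrite lerN2.
Qed.

Lemma is_basis_mem (V : X -> Prop) l (e : 'I_l -> X) i : is_basis V e -> V (e i).
Proof.
case=> span _; apply/span; exists (fun j => (j == i)%:R).
rewrite (bigD1 i) //= eqxx rmorph1 mul1r big1 ?addr0 // => j /negbTE ->.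
by rewrite rmorph0 mul0r.
Qed.

Lemma is_basis_neq0 (V : X -> Prop) l (e : 'I_l -> X) i : is_basis V e -> e i != 0.
Proof.
case=> _ indep; apply/eqP => e0.
have s0 : \sum_j cst X (j == i)%:R * e j = 0.
  rewrite (bigD1 i) //= e0 mulr0 big1 ?addr0 // => j /negbTE ->.
  by rewrite rmorph0 mul0r.
by have /eqP := indep _ s0 i; rewrite eqxx oner_eq0.
Qed.

Lemma lin_indep_le_dim (V : X -> Prop) l l' (w : 'I_l' -> X) :
  has_dim V l -> (forall i, V (w i)) -> lin_indep (cst X) w -> (l' <= l)%N.
Proof.
move=> [e [span _]] Vw; apply: lin_indep_le => j.
by apply/span/Vw.
Qed.

Lemma lin_indep_distinct p n (w : 'I_n -> X) :
  (forall i, w i != 0) -> (forall i j, ord p (w i) = ord p (w j) -> i = j) ->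
  lin_indep (cst X) w.
Proof.
move=> w0 inj c s0 i.
have ordc j : cst X (c j) * w j != 0 -> ord p (cst X (c j) * w j) = ord p (w j).
  rewrite mulf_eq0 negb_or fmorph_eq0 => /andP [cj wj].
  by rewrite valM ?fmorph_eq0 // ord_cst // add0r.
have /eqP : cst X (c i) * w i = 0.
  apply: (val_sum_eq0 (ord_valuation p) _ s0) => j k cj ck.
  by rewrite !ordc //; apply: inj.
by rewrite mulf_eq0 (negbTE (w0 i)) orbF fmorph_eq0 => /eqP.
Qed.

End CurveBasics.

(** * Riemann's theorem *)

Section Riemann.
Local Open Scope ring_scope.
Variables (R : realType) (X : curve R) (g : nat).
Hypothesis genus_X : has_genus X g.
Implicit Types (p q : cpoint X) (D E : divisor X) (f : X).

Lemma riemann_dim D :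
  exists2 l : nat, has_dim (rr_space D) l & deg D + 1 - g%:Z <= l%:Z.
Proof. by case: genus_X => + _; apply. Qed.

Lemma rr_space_cst c : rr_space (0 : divisor X) (cst X c).
Proof. by apply/rr_spaceP => p; rewrite coeff0 oppr0 vge_cst. Qed.

Lemma rr_spaceX D f n : rr_space D f -> rr_space (D *+ n) (f ^+ n).
Proof.
move=> Df; elim: n => [|n IH].
  by rewrite expr0 mulr0n -(rmorph1 (cst X)); apply: rr_space_cst.
by rewrite exprS mulrS; apply: rr_spaceM.
Qed.

Variable P : cpoint X.

(** Subtract the value at P. A nonzero difference would vanish at P, so its powers would have
    distinct orders there and be independent in the finite-dimensional L(0). *)
Lemma rr_space_constant f : rr_space (0 : divisor X) f -> exists c, f = cst X c.
Proof.
move=> f0.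
have /vge_value [c hc] : vge (ord P) 0 f.
  by move/rr_spaceP: (f0) => /(_ P); rewrite coeff0 oppr0.
exists c; apply/eqP; rewrite -subr_eq0; apply: contraT => h0.
have h_L := rr_spaceB f0 (rr_space_cst c).
move: (f - cst X c) hc h0 h_L => h hc h0 h_L.
rewrite vge_neq0 // in hc.
have [l dim_l _] := riemann_dim 0.
have hX i : rr_space (0 : divisor X) (h ^+ i) by rewrite -(mul0rn _ i); apply: rr_spaceX.
have := @lin_indep_le_dim _ _ _ l l.+1 (fun i => h ^+ i) dim_l (fun i => hX i).
rewrite ltnn; apply; apply: (lin_indep_distinct (p := P)) => [i|i j].
  by rewrite expf_neq0.
rewrite !(valX (ord_valuation P)) // => e; apply/val_inj => /=; apply/eqP.
move: e => /eqP; rewrite -[_ *+ i]mulr_natr -[_ *+ j]mulr_natr.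
rewrite (inj_eq (mulfI _)) ?pnatr_eq0 ?eqr_nat //.
by rewrite gt_eqF.
Qed.

Lemma has_dim_cst : has_dim (rr_space (0 : divisor X)) 1.
Proof.
exists (fun=> 1); split=> [f|c].
  split=> [/rr_space_constant [c ->]|[c ->]].
    by exists (fun=> c); rewrite big_ord1 mulr1.
  by rewrite big_ord1 mulr1; apply: rr_space_cst.
by rewrite big_ord1 mulr1 => /eqP; rewrite fmorph_eq0 => /eqP c0 i; rewrite ord1.
Qed.

(** This replaces the fact that principal divisors have degree 0. If deg D < 0, Riemann's inequality
    makes L(-(g+1)D) at least two-dimensional, and multiplication by f^(g+1) embeds it into L(0),
    the constants. *)
Lemma rr_space_deg D f : rr_space D f -> f != 0 -> 0 <= deg D.
Proof.
move=> Df f0; rewrite leNgt; apply/negP => degD.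
have [l [e be] hl] := riemann_dim (- D *+ g.+1).
have w_L i : rr_space (0 : divisor X) (e i * f ^+ g.+1).
  rewrite -(addNr (D *+ g.+1)) -mulNrn; apply: rr_spaceM; last exact: rr_spaceX.
  exact: is_basis_mem be.
have := lin_indep_le_dim has_dim_cst w_L.
have -> : (l <= 1)%N = false.
  apply/negbTE; rewrite -ltnNge -ltz_nat; apply: lt_le_trans hl.
  rewrite degMn degN -mulr_natr; nia.
move=> /(_ _)/negP; apply=> // c; under eq_bigr => i _ do rewrite mulrA.
rewrite -mulr_suml => /eqP; rewrite mulf_eq0 expf_eq0 (negbTE f0) orbF.
by case: be => _ indep /eqP /indep.
Qed.

Definition point_sum (s : seq (cpoint X)) : divisor X := \sum_(p <- s) << p >>.

Lemma deg_point_sum s : deg (point_sum s) = (size s)%:Z.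
Proof.
rewrite /point_sum; elim: s => [|p s IH]; first by rewrite big_nil deg0.
by rewrite big_cons degD IH degU /=; lia.
Qed.

Lemma point_sum_ge0 s p : 0 <= coeff p (point_sum s).
Proof.
rewrite /point_sum raddf_sum /=; apply: sumr_ge0 => q _.
by rewrite coeffU mul1r ler0n.
Qed.

(* The points of [s] are added one by one, as long as [f] stays in
   L(D - s); the degree bounds the length of [s]. *)
Lemma rr_space_divisor D f : rr_space D f -> f != 0 ->
  exists2 s, (size s)%:Z <= deg D &
    forall p, coeff p (point_sum s) = coeff p D + ord p f.
Proof.
move=> Df f0; pose good n := `[< exists2 s : seq (cpoint X),
  size s = n & rr_space (D - point_sum s) f >].
have good0 : exists n, good n.
  exists 0%N; apply/asboolP; exists [::] => //.
  by rewrite /point_sum big_nil subr0.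
have good_deg n : good n -> n%:Z <= deg D.
  move=> /asboolP [s <- Ds]; have := rr_space_deg Ds f0.
  by rewrite degB deg_point_sum subr_ge0.
have good_le n : good n -> (n <= `|deg D|)%N.
  by move=> /good_deg; lia.
case: (ex_maxnP good0 good_le) => n /[dup] gn /asboolP [s sn Ds] maxn.
exists s => [|p]; first by rewrite sn good_deg.
have hp : coeff p (point_sum s) <= coeff p D + ord p f.
  by move/rr_spaceP: Ds => /(_ p); rewrite coeffB vge_neq0 //; lia.
apply/eqP; rewrite eq_le hp leNgt; apply/negP => lt.
suff /maxn : good n.+1 by rewrite ltnn.
apply/asboolP; exists (p :: s); first by rewrite /= sn.
apply/rr_spaceP => q; rewrite /point_sum big_cons coeffB coeffD coeffU mul1r.
move/rr_spaceP: Ds => /(_ q); rewrite coeffB !vge_neq0 // -/(point_sum s).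
by have [<-|_] := eqVneq; move: lt; rewrite /=; lia.
Qed.

(** Fix one basis function [e i0] whose pole at [p] exceeds what D allows. Subtracting multiples of
    it brings all the others into L(D) and keeps them independent. *)
Lemma dim_add_point D p l l' :
  has_dim (rr_space D) l -> has_dim (rr_space (D + << p >>)) l' -> (l' <= l.+1)%N.
Proof.
move=> dim_l [e be].
have e_L i : rr_space (D + << p >>) (e i) by exact: is_basis_mem be.
case: (be) => _ indep.
have to_D f : rr_space (D + << p >>) f -> vge (ord p) (- coeff p D) f ->
    rr_space D f.
  move=> /rr_spaceP f_L fp; apply/rr_spaceP => q.
  have [<-//|pq] := eqVneq p q.
  by have := f_L q; rewrite coeffD coeffU (negbTE pq) mulr0 addr0.
have [all_in|/existsNP [i0 /negP i0P]] := pselect (forall i, vge (ord p) (- coeff p D) (e i)).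
  by apply: leqW; apply: lin_indep_le_dim dim_l _ indep => i; apply: to_D.
have ei0 : e i0 != 0 by apply: contraNneq i0P => ->; rewrite vge0.
have ord_i0 : ord p (e i0) = - coeff p D - 1.
  have /rr_spaceP/(_ p) := e_L i0; move: i0P.
  by rewrite !vge_neq0 // coeffD coeffU eqxx mulr1; lia.
have /choice [c cP] : forall i, exists c : R[i],
    vge (ord p) (- coeff p D) (e i - cst X c * e i0).
  move=> i; rewrite (_ : - _ = (- coeff p D - 1) + 1); last by lia.
  apply: vge_lead => //.
  have /rr_spaceP/(_ p) := e_L i; rewrite coeffD coeffU eqxx mulr1.
  by apply: vge_le; lia.
case: l' e be indep e_L i0 i0P ei0 ord_i0 c cP => [|l'] e _ indep e_L i0 _ _ _ c cP.
  by [].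
rewrite ltnS; apply: (lin_indep_le_dim dim_l
  (w := fun j : 'I_l' => e (fintype.lift i0 j) - cst X (c (fintype.lift i0 j)) * e i0)) => [j|d s0 j].
  by apply: to_D => //; apply: rr_spaceB => //; apply: rr_space_scale.
(* A relation between the corrected functions is a relation between the [e i] in which [e i0]
   collects all corrections. *)
pose d' i := if fintype.unlift i0 i is Some j then d j
             else - \sum_j d j * c (fintype.lift i0 j).
have := indep d' _ (fintype.lift i0 j); rewrite /d' fintype.liftK; apply.
rewrite (bigD1_ord i0) //= unlift_none -[RHS]s0 addrC.
under eq_bigr => k _ do rewrite fintype.liftK.
under [RHS]eq_bigr => k _ do rewrite mulrBr.
rewrite sumrB; congr (_ + _); rewrite rmorphN mulNr rmorph_sum mulr_suml.
by congr (- _); apply: eq_bigr => k _; rewrite rmorphM mulrA.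
Qed.

(** Minimality of the genus: g - 1 fails as a Riemann bound for some divisor. For g = 0 the divisor
    0 serves, since L(0) has dimension 1. *)
Lemma exists_dim_le : exists D0 : divisor X, forall l,
  has_dim (rr_space D0) l -> l%:Z <= deg D0 + 1 - g%:Z.
Proof.
case: (posnP g) => [g0|g_gt0].
  exists 0 => l [e be]; rewrite deg0 g0.
  suff : (l <= 1)%N by lia.
  apply: lin_indep_le_dim has_dim_cst (fun i => is_basis_mem i be) _.
  by case: be.
have : ~ riemann_bound X g.-1.
  by case: genus_X => _ min /min; rewrite leqNgt ltn_predL g_gt0.
move=> /existsNP [D0 hD0]; exists D0 => l dim_l.
rewrite leNgt; apply/negP => lt; apply: hD0; exists l => //.
move: lt; lia.
Qed.

(** Each added point raises the degree by one and the dimension by at most one, so the upper bound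
    at [D0] persists. *)
Lemma exists_dim_point_sum : exists D0 : divisor X, forall s l,
  has_dim (rr_space (D0 + point_sum s)) l ->
  l%:Z <= deg D0 + (size s)%:Z + 1 - g%:Z.
Proof.
have [D0 hD0] := exists_dim_le; exists D0; elim=> [|p s IH] l.
  by rewrite /point_sum big_nil !addr0; apply: hD0.
rewrite /point_sum big_cons addrCA addrC => dim_l.
have [l0 dim0 _] := riemann_dim (D0 + point_sum s).
have := dim_add_point dim0 dim_l; have := IH _ dim0; rewrite /=; lia.
Qed.

(** For large degree, L(D - D0) contains some nonzero [f]. Then D is linearly equivalent to D0 plus
    an effective divisor, and division by [f] carries L(D) into a space of known dimension. *)
Lemma riemann_upper : exists N0 : int, forall D l,
  N0 <= deg D -> has_dim (rr_space D) l -> l%:Z <= deg D + 1 - g%:Z.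
Proof.
have [D0 hD0] := exists_dim_point_sum.
exists (deg D0 + g%:Z) => D l degD [e be].
have e_L i : rr_space D (e i).
  exact: is_basis_mem be.
have [k [u bu] hk] := riemann_dim (D - D0).
have k_gt0 : (0 < k)%N by move: hk; rewrite degB; lia.
pose i0 := Ordinal k_gt0.
pose f := u i0.
have f0 : f != 0 by exact: is_basis_neq0 bu.
have f_L : rr_space (D - D0) f by exact: is_basis_mem bu.
have [s size_s hs] := rr_space_divisor f_L f0.
have [l' dim_l' _] := riemann_dim (D0 + point_sum s).
have : (l <= l')%N.
  apply: (lin_indep_le_dim dim_l' (w := fun i => e i / f)) => [i|c].
    apply/rr_spaceP => p; rewrite coeffD hs coeffB.
    have -> : - (coeff p D0 + (coeff p D - coeff p D0 + ord p f))
       = - coeff p D + ord p f^-1.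
      rewrite (valV (ord_valuation p) f0).
      by move: (coeff p D0) (coeff p D) (ord p f) => x y z; lia.
    apply: vgeM; first exact: ord_valuation; last exact: vge_val.
    by move/rr_spaceP: (e_L i).
  under eq_bigr => i _ do rewrite mulrA.
  rewrite -mulr_suml => /eqP; rewrite mulf_eq0 invr_eq0 (negbTE f0) orbF.
  by case: be => _ indep /eqP /indep.
by have := hD0 _ _ dim_l'; move: size_s; rewrite degB; lia.
Qed.

(** Otherwise L(D) would lie in L(D - p), whose dimension is known to be smaller by one in large
    degree. *)
Lemma exists_exact_pole : exists N0 : int, forall D p, N0 <= deg D ->
  exists f, [/\ f != 0, rr_space D f & ord p f = - coeff p D].
Proof.
have [N0 hN0] := riemann_upper; exists (N0 + 1) => D p degD.
have [l [e be] hl] := riemann_dim D.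
have e_L i : rr_space D (e i).
  exact: is_basis_mem be.
apply: contrapT => none.
have [l' dim_l' _] := riemann_dim (D - << p >>).
have deg_p : deg (D - << p >>) = deg D - 1 by rewrite degB degU.
have : (l <= l')%N.
  case: be => _ /(lin_indep_le_dim dim_l'); apply=> i; apply/rr_spaceP => q.
  move/rr_spaceP: (e_L i) => /(_ q); rewrite coeffB coeffU mul1r.
  have [<-|_] := eqVneq p q; last by rewrite subr0.
  have [->|ei] := eqVneq (e i) 0; first by rewrite !vge0.
  rewrite !vge_neq0 //= opprB addrC lezD1 le_eqVlt => /orP [/eqP e0|//].
  by case: none; exists (e i); split.
have := hN0 _ _ _ dim_l'; rewrite deg_p => /(_ _)/[swap]; lia.
Qed.

(** Away from [p] the divisor mp itself has no base point, so only the point [p] imposes a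
    condition: some function must attain the full pole. *)
Lemma WS_P p (m : nat) : WS p m <->
  exists f, [/\ f != 0, rr_space (mpt m p) f & ord p f = - m%:Z].
Proof.
split=> [[->|/(_ p) [E [effE [f [f0 hf]]] Ep]]|[f [f0 f_L fp]]].
- exists 1; split; first exact: oner_neq0.
    apply/rr_spaceP => q; rewrite -(rmorph1 (cst X)) /mpt coeffU mul0r oppr0.
    exact: vge_cst.
  by rewrite oppr0 val1 //; apply: ord_valuation.
- exists f; split=> //; first by right=> q; rewrite -hf.
  by move: (hf p); rewrite Ep /mpt coeffU eqxx mulr1; lia.
have [s _ hs] := rr_space_divisor f_L f0.
right=> q; have [<-|pq] := eqVneq p q.
  exists (point_sum s); last by rewrite hs fp /mpt coeffU eqxx mulr1 subrr.
  split; first by move=> t; apply: point_sum_ge0.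
  by exists f; split.
exists (mpt m p); last by rewrite /mpt coeffU (negbTE pq) mulr0.
split=> [t|]; first by rewrite /mpt coeffU mulr_ge0 // ler0n.
exists 1; split=> [|t]; first exact: oner_neq0.
by rewrite val1 ?addr0 //; apply: ord_valuation.
Qed.

(** Every point has at least g gaps: functions with distinct pole orders below N are independent in
    L((N-1)p), of dimension at most N - g. *)
Lemma nongap_count p : exists N0 : nat, forall N (ns : seq nat), (N0 <= N)%N ->
  uniq ns -> {in ns, forall m, WS p m /\ (m < N)%N} -> (size ns + g <= N)%N.
Proof.
have [N0 hN0] := riemann_upper.
exists `|N0|.+1 => N ns N_ge uniq_ns ns_WS.
have N_gt0 : (0 < N)%N by apply: leq_trans N_ge.
have /choice [f hf] : forall i : 'I_(size ns), exists f : X,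
    [/\ f != 0, rr_space (mpt N.-1 p) f & ord p f = - (tnth (in_tuple ns) i)%:Z].
  move=> i; have [/WS_P [f [f0 f_L fp]] lt] := ns_WS _ (mem_tnth i (in_tuple ns)).
  exists f; split=> //; apply: rr_space_le f_L => q.
  rewrite /mpt !coeffU ler_wpM2r ?ler0n // lez_nat.
  by rewrite -ltnS prednK.
have [l dim_l _] := riemann_dim (mpt N.-1 p).
have : (size ns <= l)%N.
  apply: (lin_indep_le_dim dim_l (w := f)) => [i|]; first by case: (hf i).
  apply: (lin_indep_distinct (p := p)) => [i|i j]; first by case: (hf i).
  have [_ _ ->] := hf i; have [_ _ ->] := hf j.
  move/oppr_inj => [e]; apply: (tuple_uniqP (in_tuple ns) _) => //.
have := hN0 (mpt N.-1 p) l; rewrite /mpt degU => /(_ _ dim_l) h.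
have {h} := h _; move=> /(_ _)/[swap]; lia.
Qed.

End Riemann.

(** * Newton polygons of characteristic polynomials *)

Section NewtonWeights.
Local Open Scope ring_scope.
Variable F : fieldType.
Variables (al ka : int).

(** The support of a polynomial in Y (inner variable, exponent e) and Z (outer variable, exponent i)
    lies in a half-plane. Integer weights allow both signs: positive ones at a zero, negative ones
    at a pole. *)
Definition newton_ge (n : int) (p : {poly {poly F}}) : Prop :=
  forall i e, p`_i`_e != 0 -> n <= al * e%:Z + ka * i%:Z.

Lemma newton_ge0 n : newton_ge n 0.
Proof. by move=> i e; rewrite coef0 coef0 eqxx. Qed.

Lemma newton_geD n p q : newton_ge n p -> newton_ge n q -> newton_ge n (p + q).
Proof.
move=> hp hq i e; rewrite !coefD => h.
have [p0|] := eqVneq p`_i`_e 0; last exact: hp.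
by apply: hq; move: h; rewrite p0 add0r.
Qed.

Lemma newton_geN n p : newton_ge n p -> newton_ge n (- p).
Proof. by move=> hp i e; rewrite !coefN oppr_eq0; apply: hp. Qed.

Lemma newton_ge_sum (I : Type) (r : seq I) (P : pred I) n (G : I -> {poly {poly F}}) :
  (forall i, P i -> newton_ge n (G i)) -> newton_ge n (\sum_(i <- r | P i) G i).
Proof.
by move=> h; elim/big_ind: _ => //; [exact: newton_ge0 | exact: newton_geD].
Qed.

Lemma newton_geM m n p q :
  newton_ge m p -> newton_ge n q -> newton_ge (m + n) (p * q).
Proof.
move=> hp hq i e; rewrite coefM coef_sum => h.
have [j hj] : exists j : 'I_i.+1, (p`_j * q`_(i - j))`_e != 0.
  apply/existsP; apply: contraT; rewrite negb_exists => /forallP h0.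
  by move: h; rewrite big1 ?eqxx // => j _; apply/eqP; have := h0 j; rewrite negbK.
rewrite coefM in hj.
have [k hk] : exists k : 'I_e.+1, p`_j`_k * q`_(i - j)`_(e - k) != 0.
  apply/existsP; apply: contraT; rewrite negb_exists => /forallP h0.
  by move: hj; rewrite big1 ?eqxx // => k _; apply/eqP; have := h0 k; rewrite negbK.
move: hk; rewrite mulf_eq0 negb_or => /andP [/hp hpk /hq hqk].
have -> : e%:Z = k%:Z + (e - k)%N%:Z by have := ltn_ord k; lia.
have -> : i%:Z = j%:Z + (i - j)%N%:Z by have := ltn_ord j; lia.
by rewrite !mulrDr addrACA; apply: lerD.
Qed.

Lemma newton_ge1 : newton_ge 0 1.
Proof.
move=> i e; rewrite coef1; case: i => [|i]; last by rewrite coef0 eqxx.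
by rewrite coef1; case: e => [|e]; rewrite ?eqxx // !mulr0.
Qed.

Lemma newton_ge_prod (I : finType) (w : I -> int) (G : I -> {poly {poly F}}) :
  (forall i, newton_ge (w i) (G i)) -> newton_ge (\sum_i w i) (\prod_i G i).
Proof.
move=> h; elim/big_rec2: _ => [|i p n _ IH]; first exact: newton_ge1.
exact: newton_geM.
Qed.

Variables (a : nat) (M : 'M[{poly F}]_a) (w : 'I_a -> int).
Hypothesis wtM : forall j l e, (M j l)`_e != 0 -> ka + w j <= al * e%:Z + w l.

(** The entry (j, l) of Z - M has weight at least ka + w j - w l. Along any permutation the [w]
    cancel, so every term of the determinant has weight at least a times ka. *)
Lemma newton_char_poly : newton_ge (ka * a%:Z) (char_poly M).
Proof.
rewrite /char_poly /determinant; apply: newton_ge_sum => s _.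
rewrite -[ka * a%:Z]add0r; apply: newton_geM.
  elim: (nat_of_bool _) => [|k IH]; first exact: newton_ge1.
  by rewrite exprS mulN1r; apply: newton_geN.
have -> : ka * a%:Z = \sum_(i < a) (ka + w i - w (s i)).
  rewrite sumrB big_split /= sumr_const card_ord -mulr_natr.
  rewrite (reindex_inj (@perm_inj _ s) (F := w)) /= addrK; congr (_ * _).
  by rewrite natz.
apply: newton_ge_prod => i k e; rewrite !mxE coefB coefMn coefX coefC.
case: k => [|k] /=.
  rewrite mul0rn add0r coefN oppr_eq0 => /wtM; lia.
rewrite subr0; case: k => [|k] /=; last by rewrite mul0rn coef0 eqxx.
case: (i =P s i) => [<-|_]; last by rewrite mulr0n coef0 eqxx.
by rewrite mulr1n coef1; case: e => [|e] /=; rewrite ?eqxx // => _; lia.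
Qed.

Lemma newton_det e : (\det M)`_e != 0 -> ka * a%:Z <= al * e%:Z.
Proof.
move=> h; have := @newton_char_poly 0%N e.
rewrite char_poly_det coefM -[(-1) ^+ a]signr_odd.
move=> H; rewrite -[X in _ <= X]addr0 -(mulr0 ka); apply: H.
rewrite -coefM; case: (odd a); rewrite ?expr0 ?expr1 ?mul1r //.
by rewrite mulN1r coefN oppr_eq0.
Qed.

End NewtonWeights.

(** * Polynomials evaluated at functions, and the orders of their values *)

Section Evaluation.
Local Open Scope ring_scope.
Variables (F K : fieldType) (iota : {rmorphism F -> K}).
Implicit Types (c : F) (y z : K) (p : {poly F}) (q : {poly {poly F}}).

Definition ev (y : K) : {poly F} -> K := horner_eval y \o map_poly iota.
HB.instance Definition _ y := GRing.RMorphism.copy (ev y) (horner_eval y \o map_poly iota).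

Definition ev2 (y z : K) : {poly {poly F}} -> K := horner_eval z \o map_poly (ev y).
HB.instance Definition _ y z :=
  GRing.RMorphism.copy (ev2 y z) (horner_eval z \o map_poly (ev y)).

Lemma evC y c : ev y c%:P = iota c.
Proof. by rewrite /ev /= map_polyC /= horner_evalE hornerC. Qed.

Lemma evX y : ev y 'X = y.
Proof. by rewrite /ev /= map_polyX horner_evalE hornerX. Qed.

Lemma evE y p : ev y p = \sum_(e < size p) iota p`_e * y ^+ e.
Proof.
rewrite /ev /= horner_evalE horner_coef size_map_poly.
by apply: eq_bigr => e _; rewrite coef_map.
Qed.

Lemma ev2C y z p : ev2 y z p%:P = ev y p.
Proof. by rewrite /ev2 /= map_polyC /= horner_evalE hornerC. Qed.

Lemma ev2X y z : ev2 y z 'X = z.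
Proof. by rewrite /ev2 /= map_polyX horner_evalE hornerX. Qed.

Lemma ev2E_wide n y z (q : {poly {poly F}}) : (size q <= n)%N ->
  ev2 y z q = \sum_(i < n) ev y q`_i * z ^+ i.
Proof.
move=> size_q; rewrite /ev2 /= horner_evalE (@horner_coef_wide _ n).
  by apply: eq_bigr => e _; rewrite coef_map.
exact: leq_trans (size_poly _ _) size_q.
Qed.

(** The row of the [f l] is a left eigenvector of M(y) for the eigenvalue z. *)
Lemma ev2_char_poly a (M : 'M[{poly F}]_a) (f : 'I_a -> K) y z l0 :
  f l0 != 0 -> (forall l, z * f l = \sum_j ev y (M j l) * f j) ->
  ev2 y z (char_poly M) = 0.
Proof.
move=> f0 hf; rewrite /ev2 /= horner_evalE map_char_poly; apply/eqP.
rewrite -[_ == 0]/(root _ _) -eigenvalue_root_char; apply/eigenvalueP.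
exists (\row_l f l).
  apply/rowP => l; rewrite !mxE hf; apply: eq_bigr => j _.
  by rewrite !mxE mulrC.
by apply/eqP => /rowP /(_ l0); rewrite !mxE; apply/eqP.
Qed.

Variable v : K -> int.
Hypothesis val_v : is_valuation v.
Hypothesis v_cst : forall c, c != 0 -> v (iota c) = 0.

Lemma val_term y c e : y != 0 -> c != 0 ->
  iota c * y ^+ e != 0 /\ v (iota c * y ^+ e) = v y * e%:Z.
Proof.
move=> y0 c0; have ye : y ^+ e != 0 by rewrite expf_neq0.
rewrite mulf_neq0 ?fmorph_eq0 // valM ?fmorph_eq0 //.
by rewrite v_cst // add0r valX // -mulr_natr natz.
Qed.

(** As [v y] is nonzero, distinct powers of y have distinct orders and cannot cancel. *)
Lemma val_ev y p : y != 0 -> v y != 0 -> p != 0 ->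
  ev y p != 0 /\ exists2 e, p`_e != 0 & v (ev y p) = v y * e%:Z.
Proof.
move=> y0 vy p0; rewrite evE.
have term (i : 'I_(size p)) : iota p`_i * y ^+ i != 0 ->
    p`_i != 0 /\ v (iota p`_i * y ^+ i) = v y * i%:Z.
  rewrite mulf_eq0 negb_or fmorph_eq0 => /andP [pi _]; split=> //.
  by have [] := val_term i y0 pi.
have size_p : (0 < size p)%N by rewrite size_poly_gt0.
have lt : ((size p).-1 < size p)%N by rewrite prednK.
have [||-> [i hi [-> _]]] := @val_sum_neq _ _ val_v _
    (fun i : 'I_(size p) => iota p`_i * y ^+ i) (Ordinal lt).
- by have [] := @val_term y p`_(size p).-1 (size p).-1 y0 _; rewrite ?lead_coef_eq0.
- move=> i j /term [_ ->] /term [_ ->] /(mulfI vy) [e]; exact: val_inj.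
by split=> //; have [pi ->] := term _ hi; exists i.
Qed.

Lemma vge_ev y p n : y != 0 -> (forall e, p`_e != 0 -> n <= v y * e%:Z) ->
  vge v n (ev y p).
Proof.
move=> y0 h; rewrite evE; apply: vge_sum => // i _.
have [->|pi] := eqVneq p`_i 0; first by rewrite rmorph0 mul0r vge0.
by have [t0 vt] := val_term i y0 pi; rewrite vge_neq0 // vt h.
Qed.

Lemma ev_indep (a : nat) y (f : 'I_a -> K) (p : 'I_a -> {poly F}) :
  y != 0 -> v y != 0 -> (forall l, f l != 0) ->
  (forall l l' e e', v y * e%:Z + v (f l) = v y * e'%:Z + v (f l') -> l = l') ->
  \sum_l ev y (p l) * f l = 0 -> forall l, p l = 0.
Proof.
move=> y0 vy f0 inj s0 l; apply/eqP; apply: contraT => pl.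
have term j : ev y (p j) * f j != 0 ->
    exists e, v (ev y (p j) * f j) = v y * e%:Z + v (f j).
  rewrite mulf_eq0 negb_or => /andP [pj _].
  have pj0 : p j != 0 by apply: contraNneq pj => ->; rewrite rmorph0.
  have [h [e _ he]] := val_ev y0 vy pj0.
  by exists e; rewrite valM // he.
have /eqP : ev y (p l) * f l = 0.
  apply: (val_sum_eq0 val_v _ s0) => i j /term [e ->] /term [e' ->]; exact: inj.
by rewrite mulf_eq0 (negbTE (f0 l)) orbF; case: (val_ev y0 vy pl) => /negbTE ->.
Qed.

(* Modulo [a] the orders of the powers [z ^+ i], [i < a], are distinct. *)
Lemma ev2_eq0_size (a b : nat) y z (q : {poly {poly F}}) :
  coprime a b -> (0 < a)%N -> y != 0 -> z != 0 ->
  v y = - a%:Z -> v z = - b%:Z -> q != 0 -> ev2 y z q = 0 -> (a < size q)%N.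
Proof.
move=> cop a0 y0 z0 vy vz q0 q_root; rewrite ltnNge; apply: contra_neqN q0 => size_q.
apply/polyP => i; rewrite coef0; have [ia|ai] := ltnP i a; last first.
  by rewrite nth_default // (leq_trans size_q).
rewrite (ev2E_wide _ _ size_q) in q_root.
apply: (@ev_indep _ y (fun l : 'I_a => z ^+ l) (fun l : 'I_a => q`_l) _ _ _ _ q_root
  (Ordinal ia)) => //.
- by rewrite vy oppr_eq0; lia.
- by move=> l; rewrite expf_neq0.
move=> l l' e e'; rewrite !(valX val_v) // vy vz -[_ *+ l]mulr_natr -[_ *+ l']mulr_natr !natz => h.
have : (a * e + b * l = a * e' + b * l')%N by lia.
move/(congr1 (modn^~ a)); rewrite ![(a * _)%N]mulnC !modnMDl => /eqP h'.
apply: val_inj => /=; wlog le : l l' e e' h h' / (l <= l')%N.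
  by move=> W; case/orP: (leq_total l l') => le; [|apply/esym];
    apply: (W _ _ _ _ _ _ le); rewrite ?(eqP h') //; [exact: h | exact/esym/h].
apply/eqP; rewrite eqn_leq le /=.
move: h'; rewrite eq_sym eqn_mod_dvd ?leq_mul2l ?le ?orbT // -mulnBr.
rewrite Gauss_dvdr // => /dvdn_leq; have := ltn_ord l'; lia.
Qed.

End Evaluation.

(** * Bases adapted to one or two points *)

Section Bases.
Local Open Scope ring_scope.
Variables (R : realType) (X : curve R) (g : nat).
Hypothesis genus_X : has_genus X g.
Variables (P : cpoint X) (a : nat) (y : X).
Hypotheses (a_gt0 : (0 < a)%N) (y_neq0 : y != 0).
Implicit Types (D : divisor X) (f h : X).

Local Notation evy := (ev (cst X) y).

Lemma deg_point (Q : cpoint X) n : deg (<< n *g Q >> : divisor X) = n.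
Proof. exact: degU. Qed.

Lemma coeff_point (p Q : cpoint X) n :
  coeff p (<< n *g Q >> : divisor X) = if Q == p then n else 0.
Proof. by rewrite coeffU; case: eqP; rewrite ?mulr1 ?mulr0. Qed.

Lemma sum_ev_add1 (f : 'I_a -> X) (q : 'I_a -> {poly R[i]}) h c l0 e0 :
  h - cst X c * (y ^+ e0 * f l0) = \sum_l evy (q l) * f l ->
  h = \sum_l evy (q l + if l == l0 then c *: 'X^e0 else 0) * f l.
Proof.
move=> hE; under eq_bigr => l _ do rewrite rmorphD mulrDl.
rewrite big_split /= -hE (bigD1 l0) //= eqxx big1 ?addr0 => [|l /negbTE ->].
  by rewrite -mul_polyC rmorphM rmorphXn /= evC evX mulrA subrK.
by rewrite rmorph0 mul0r.
Qed.

Lemma coef_add1 (q : 'I_a -> {poly R[i]}) c l0 e0 l e :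
  (q l + if l == l0 then c *: 'X^e0 else 0)`_e != 0 ->
  (q l)`_e != 0 \/ (l = l0 /\ e = e0).
Proof.
rewrite coefD; have [q0|] := eqVneq (q l)`_e 0; last by left.
rewrite q0 add0r; have [->|_] := eqVneq l l0; last by rewrite coef0 eqxx.
rewrite coefZ coefXn; have [->|_] := eqVneq e e0; first by right.
by rewrite mulr0 eqxx.
Qed.

Section TwoPoints.
Variable Q : cpoint X.
Hypothesis PQ : P != Q.
Hypothesis div_y : forall p, coeff p (mpt a Q) = coeff p (mpt a P) + ord p y.

Local Notation div2 m i := (<< m *g P >> + << i *g Q >> : divisor X).

Lemma ord_yQ : ord Q y = a%:Z.
Proof.
by move: (div_y Q); rewrite /mpt !coeff_point eqxx (negbTE PQ) add0r.
Qed.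

Lemma ord_yP : ord P y = - a%:Z.
Proof.
move: (div_y P); rewrite /mpt !coeff_point eqxx eq_sym (negbTE PQ); lia.
Qed.

Lemma rr_space_y s : rr_space (div2 (s * a%:Z) (- (s * a%:Z))) (y ^ s).
Proof.
right=> p; rewrite coeffD !coeff_point.
have -> : ord p (y ^ s) = s * ord p y.
  case: s => n; first by rewrite -exprnP (valX (ord_valuation p)) // -mulr_natl natz.
  rewrite NegzE -exprnN (valV (ord_valuation p)) ?expf_neq0 //.
  by rewrite (valX (ord_valuation p)) // -mulr_natl natz mulNr.
have := div_y p; rewrite /mpt !coeff_point.
move=> /eqP; rewrite [X in _ == X]addrC -subr_eq => /eqP <-.
by case: eqP => _; case: eqP => _; lia.
Qed.

(** The leading term of h at Q is cancelled by some c y^e f_l, where e and l are the quotient and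
    remainder of the order by a. Minimality of the pole of f_l at P ensures that the subtraction
    creates no larger pole at P, so the degree of the divisor m P + i Q drops until h is 0. *)
Lemma two_point_basis : exists f : 'I_a -> X,
  (forall l, [/\ f l != 0, ord Q (f l) = - l%:Z &
     exists m : int, rr_space (div2 m l%:Z) (f l)]) /\
  (forall (m i : int) h, i < a%:Z -> rr_space (div2 m i) h ->
     exists q : 'I_a -> {poly R[i]}, h = \sum_l evy (q l) * f l /\
       forall l e, (q l)`_e != 0 -> l%:Z - i <= a%:Z * e%:Z).
Proof.
have [N0 hN0] := exists_exact_pole genus_X P.
have min_pole (l : 'I_a) : exists N : nat,
    (exists f, [/\ f != 0, ord Q f = - l%:Z & rr_space (div2 (N%:Z - l%:Z) l%:Z) f]) /\
    (forall (m : int) h, h != 0 -> ord Q h = - l%:Z ->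
      rr_space (div2 m l%:Z) h -> N%:Z <= m + l%:Z).
  (* The pole at P is measured by N - l so that N is the degree of the divisor. It cannot be
     negative, hence a least natural N exists. *)
  pose good N := `[< exists f, [/\ f != 0, ord Q f = - l%:Z &
    rr_space (div2 (N%:Z - l%:Z) l%:Z) f] >].
  have ex_good : exists N, good N.
    exists `|N0|%N; apply/asboolP.
    have [|f [f0 fL fQ]] := hN0 (div2 (`|N0|%N%:Z - l%:Z) l%:Z) Q.
      by rewrite degD !deg_point; lia.
    by exists f; split=> //; rewrite fQ coeffD !coeff_point eqxx (negbTE PQ) add0r.
  case: (ex_minnP ex_good) => N /asboolP gN minN; exists N; split=> // m h h0 hQ hL.
  have := rr_space_deg genus_X P hL h0; rewrite degD !deg_point => ge0.
  have : good `|(m + l%:Z)%R|%N.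
    by apply/asboolP; exists h; split=> //; rewrite (_ : _ - l%:Z = m) //; lia.
  by move/minN; lia.
have [N hN] := choice min_pole.
have [f hf] := choice (fun l => (hN l).1).
have min_f l := (hN l).2.
exists f; split=> [l|].
  by have [f0 fQ fL] := hf l; split=> //; exists ((N l)%:Z - l%:Z).
(* Induction on the degree m + i; the shift by 1 lets it descend from degree 0 to degree -1, where h
   must be 0. *)
move=> m i h; have [k] := ubnP `|(m + i + 1)%R|%N; move: i h.
elim: k => [//|k IH] i h lt_k ia hL.
have [->|h0] := eqVneq h 0.
  exists (fun=> 0); split; last by move=> l e; rewrite coef0 eqxx.
  by rewrite big1 // => l _; rewrite rmorph0 mul0r.
have := rr_space_deg genus_X P hL h0; rewrite degD !deg_point => mi_ge0.
have next h' : vge (ord Q) (- i + 1) h' -> rr_space (div2 m i) h' ->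
    exists q : 'I_a -> {poly R[i]}, h' = \sum_l evy (q l) * f l /\
      forall l e, (q l)`_e != 0 -> l%:Z - i <= a%:Z * e%:Z.
  move=> h'Q /rr_spaceP h'L.
  have [lt1 lt2] : (`|(m + (i - 1) + 1)%R| < k)%N /\ i - 1 < a%:Z by split; lia.
  have [|q [qE q_ge]] := IH (i - 1) h' lt1 lt2.
    apply/rr_spaceP => p; have := h'L p; rewrite !coeffD !coeff_point.
    have [<- _|//] := eqVneq Q p.
    by rewrite (negbTE PQ) add0r opprB addrC.
  by exists q; split=> // l e /q_ge; lia.
have hQ : - i <= ord Q h.
  move/rr_spaceP: (hL) => /(_ Q).
  by rewrite coeffD !coeff_point eqxx (negbTE PQ) add0r vge_neq0.
have [hQi|hQi] := eqVneq (ord Q h) (- i); last first.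
  by apply: next => //; rewrite vge_neq0 // lezD1 lt_neqAle eq_sym hQi.
have a0 : a%:Z != 0 by lia.
have := divz_eq i a%:Z; have := ltz_pmod i (d := a%:Z) (ltac:(lia)); have := modz_ge0 i a0.
move: (i %/ a%:Z)%Z (i %% a%:Z)%Z => s r r_ge0 r_lt iE.
have r_lt' : (`|r| < a)%N by lia.
pose l0 := Ordinal r_lt'; have l0E : l0%:Z = r by rewrite /=; lia.
have [f0 fQ fL] := hf l0.
(* The bound i < a makes the quotient nonpositive, so that only nonnegative powers of y are used. *)
have [e0 e0E] : exists e0 : nat, s = - e0%:Z by exists `|s|%N; nia.
have ye : y ^+ e0 = y ^ (- s) by rewrite e0E opprK exprnP.
have ye0 : y ^+ e0 != 0 by rewrite expf_neq0.
pose h1 := y ^+ e0 * f l0.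
have h10 : h1 != 0 by rewrite mulf_neq0.
have h1Q : ord Q h1 = - i.
  rewrite /h1 (valM (ord_valuation Q)) // (valX (ord_valuation Q)) //.
  by rewrite fQ ord_yQ -mulr_natl natz; lia.
(* h y^s has pole order exactly l0 at Q, so it competes with f_l0 in the minimality; this bounds the
   pole of y^e0 f_l0 at P by m. *)
have N_le : (N l0)%:Z <= m + s * a%:Z + l0%:Z.
  apply: (min_f l0 _ (h * y ^ s)).
  - by rewrite mulf_neq0 // expfz_neq0.
  - rewrite (valM (ord_valuation Q)) ?expfz_neq0 // hQi e0E -exprnN.
    rewrite (valV (ord_valuation Q)) ?expf_neq0 // (valX (ord_valuation Q)) //.
    by rewrite ord_yQ -mulr_natl natz; lia.
  apply: rr_space_le (rr_spaceM hL (rr_space_y s)) => p.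
  by rewrite !coeffD !coeff_point; case: eqP => _; case: eqP => _; lia.
have h1L : rr_space (div2 m i) h1.
  rewrite /h1 ye; apply: rr_space_le (rr_spaceM (rr_space_y (- s)) fL) => p.
  by rewrite !coeffD !coeff_point; case: eqP => _; case: eqP => _; lia.
have hQge : vge (ord Q) (- i) h by rewrite vge_neq0.
have [c hc] := vge_lead hQge h10 h1Q.
have [|q [qE q_ge]] := next _ hc.
  by apply: rr_spaceB => //; apply: rr_space_scale.
exists (fun l => q l + if l == l0 then c *: 'X^e0 else 0); split.
  exact: sum_ev_add1.
by move=> l e /coef_add1 [/q_ge //|[-> ->]]; lia.
Qed.

End TwoPoints.

Section OnePoint.
Hypotheses (y_L : rr_space (mpt a P) y) (ord_y : ord P y = - a%:Z).

(** The values [sg l] are the Apery set of WS(P) with respect to a: the least pole order in each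
    residue class. A function of pole order m is reduced by y^e f_l with ae + sg l = m. *)
Lemma one_point_basis : exists (f : 'I_a -> X) (sg : 'I_a -> nat),
  (forall l, f l != 0 /\ rr_space (mpt (sg l) P) (f l)) /\
  (forall (m : nat) h, rr_space (mpt m P) h ->
     exists q : 'I_a -> {poly R[i]}, h = \sum_l evy (q l) * f l /\
       forall l e, (q l)`_e != 0 -> (a * e + sg l <= m)%N).
Proof.
have [N0 hN0] := exists_exact_pole genus_X P.
have min_pole (l : 'I_a) : exists s : nat,
    (exists f, [/\ f != 0, ord P f = - s%:Z, rr_space (mpt s P) f & s = l %[mod a]]) /\
    (forall (m : nat) h, h != 0 -> ord P h = - m%:Z -> m = l %[mod a] ->
      rr_space (mpt m P) h -> (s <= m)%N).
  pose good s := `[< exists f, [/\ f != 0, ord P f = - s%:Z, rr_space (mpt s P) f &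
    s = l %[mod a]] >].
  have ex_good : exists s, good s.
    exists (l + `|N0| * a)%N; apply/asboolP.
    have [|f [f0 fL fP]] := hN0 (mpt (l + `|N0| * a)%N P) P.
      by rewrite /mpt deg_point; nia.
    exists f; split=> //; first by rewrite fP /mpt coeff_point eqxx.
    by rewrite addnC modnMDl.
  case: (ex_minnP ex_good) => s /asboolP gs mins; exists s; split=> // m h h0 hP hm hL.
  by apply: mins; apply/asboolP; exists h.
have [sg hsg] := choice min_pole.
have [f hf] := choice (fun l => (hsg l).1).
have min_f l := (hsg l).2.
exists f, sg; split=> [l|]; first by have [f0 _ fL _] := hf l.
move=> m; have [k] := ubnP m; elim: k m => [//|k IH] m lt_k h hL.
have zero_L : exists q : 'I_a -> {poly R[i]}, 0 = \sum_l evy (q l) * f l /\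
    forall l e, (q l)`_e != 0 -> (a * e + sg l <= m)%N.
  exists (fun=> 0); split; last by move=> l e; rewrite coef0 eqxx.
  by rewrite big1 // => l _; rewrite rmorph0 mul0r.
have [->//|h0] := eqVneq h 0.
have next h' : vge (ord P) (- m%:Z + 1) h' -> rr_space (mpt m P) h' ->
    exists q : 'I_a -> {poly R[i]}, h' = \sum_l evy (q l) * f l /\
      forall l e, (q l)`_e != 0 -> (a * e + sg l <= m)%N.
  move=> h'P /rr_spaceP h'L; have [->//|h'0] := eqVneq h' 0.
  have h'L' : rr_space (<< m%:Z - 1 *g P >> : divisor X) h'.
    apply/rr_spaceP => p; have := h'L p; rewrite /mpt !coeff_point.
    by case: eqP => [<- _|//]; rewrite opprB addrC.
  have := rr_space_deg genus_X P h'L' h'0; rewrite deg_point => m_gt0.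
  have m1 : m%:Z - 1 = m.-1%:Z by lia.
  rewrite m1 in h'L'.
  have [|q [qE q_ge]] := IH m.-1 _ h' h'L'; first by lia.
  by exists q; split=> // l e /q_ge; lia.
have hP : - m%:Z <= ord P h.
  by move/rr_spaceP: (hL) => /(_ P); rewrite /mpt coeff_point eqxx vge_neq0.
have [hPm|hPm] := eqVneq (ord P h) (- m%:Z); last first.
  by apply: next => //; rewrite vge_neq0 // lezD1 lt_neqAle eq_sym hPm.
pose l0 := Ordinal (ltn_pmod m a_gt0).
have ml0 : m = l0 %[mod a] by rewrite /= modn_mod.
have sg_le := min_f l0 m h h0 hPm ml0 hL.
have [f0 fP fL fm] := hf l0.
have [e0 me0] : exists e0, m = (e0 * a + sg l0)%N.
  have : (a %| m - sg l0)%N by rewrite -eqn_mod_dvd // ml0 fm.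
  by case/dvdnP => e0 h1; exists e0; rewrite -h1 subnK.
have ye0 : y ^+ e0 != 0 by rewrite expf_neq0.
pose h1 := y ^+ e0 * f l0.
have h10 : h1 != 0 by rewrite mulf_neq0.
have h1P : ord P h1 = - m%:Z.
  rewrite /h1 (valM (ord_valuation P)) // (valX (ord_valuation P)) //.
  by rewrite fP ord_y -mulr_natl natz; lia.
have h1L : rr_space (mpt m P) h1.
  rewrite /h1; apply: rr_space_le (rr_spaceM (rr_spaceX e0 y_L) fL) => p.
  rewrite coeffD coeffMn /mpt !coeff_point; case: eqP => _; last by rewrite mul0rn.
  by rewrite -mulr_natl natz; lia.
have hPge : vge (ord P) (- m%:Z) h by rewrite vge_neq0.
have [c hc] := vge_lead hPge h10 h1P.
have [|q [qE q_ge]] := next _ hc.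
  by apply: rr_spaceB => //; apply: rr_space_scale.
exists (fun l => q l + if l == l0 then c *: 'X^e0 else 0); split.
  exact: sum_ev_add1.
by move=> l e /coef_add1 [/q_ge //|[-> ->]]; lia.
Qed.

End OnePoint.
End Bases.

(** * Functions without poles outside one point *)

Section RegularOffP.
Local Open Scope ring_scope.
Variables (R : realType) (X : curve R) (P : cpoint X).
Implicit Types f h : X.

Definition regular_off f := exists B : nat, rr_space (mpt B P) f.

Lemma regular_off_le B B' f : (B <= B')%N ->
  rr_space (mpt B P) f -> rr_space (mpt B' P) f.
Proof.
move=> le; apply: rr_space_le => p; rewrite /mpt !coeff_point.
by case: ifP => // _; rewrite lez_nat.
Qed.

Lemma regular_offD f h : regular_off f -> regular_off h -> regular_off (f + h).
Proof.
move=> [B fB] [B' hB]; exists (B + B')%N; rewrite -[h]opprK.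
apply: rr_spaceB; first by apply: regular_off_le fB; lia.
rewrite -mulN1r -(rmorph1 (cst X)) -rmorphN; apply: rr_space_scale.
by apply: regular_off_le hB; lia.
Qed.

Lemma regular_offM f h : regular_off f -> regular_off h -> regular_off (f * h).
Proof.
move=> [B fB] [B' hB]; exists (B + B')%N.
apply: rr_space_le (rr_spaceM fB hB) => p; rewrite coeffD /mpt !coeff_point.
by case: ifP.
Qed.

Lemma regular_off_cst c : regular_off (cst X c).
Proof.
exists 0%N; apply: rr_space_le (rr_space_cst X c) => p.
by rewrite /mpt coeff_point coeff0; case: ifP.
Qed.

Lemma regular_off_ev2 y z q :
  regular_off y -> regular_off z -> regular_off (ev2 (cst X) y z q).
Proof.
move=> hy hz.
have hev (p : {poly R[i]}) : regular_off (ev (cst X) y p).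
  elim/poly_ind: p => [|p c IH].
    by rewrite rmorph0 -(rmorph0 (cst X)); apply: regular_off_cst.
  rewrite rmorphD rmorphM /= evX evC.
  by apply: regular_offD (regular_off_cst c); apply: regular_offM.
elim/poly_ind: q => [|q c IH].
  by rewrite rmorph0 -(rmorph0 (cst X)); apply: regular_off_cst.
rewrite rmorphD rmorphM /= ev2X ev2C.
by apply: regular_offD => //; apply: regular_offM.
Qed.

End RegularOffP.

(** * The polynomial relation between [y] and [z] at a pole and at a zero *)

Section NewtonPolygons.
Local Open Scope ring_scope.
Variables (R : realType) (X : curve R) (g : nat).
Hypothesis genus_X : has_genus X g.
Variables (P : cpoint X) (a b : nat) (y z : X).
Hypotheses (a_gt0 : (0 < a)%N) (cop : coprime a b).
Hypotheses (y_neq0 : y != 0) (z_neq0 : z != 0).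
Hypotheses (ord_y : ord P y = - a%:Z) (ord_z : ord P z = - b%:Z).

Local Notation evy := (ev (cst X) y).
Local Notation evyz := (ev2 (cst X) y z).

Lemma ev2_root_size (q : {poly {poly R[i]}}) : q != 0 -> evyz q = 0 -> (a < size q)%N.
Proof.
move=> q0 q_root.
by apply: (ev2_eq0_size (ord_valuation P) (@ord_cst R X P) cop _ y_neq0 z_neq0 _ _ q0 q_root).
Qed.

(** Multiplication by z raises pole orders at P by at most b, which bounds the matrix with weights
    -a, -b and [sg]. *)
Lemma newton_polygon_pole : rr_space (mpt a P) y -> rr_space (mpt b P) z ->
  (0 < b)%N ->
  exists G : {poly {poly R[i]}}, [/\ G \is monic, size G = a.+1, evyz G = 0,
    forall i e, G`_i`_e != 0 -> (a * e + b * i <= a * b)%N & G`_0`_b != 0].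
Proof.
move=> yL zL b_gt0.
have [f [sg [hf span]]] := one_point_basis genus_X a_gt0 y_neq0 yL ord_y.
have zf l : rr_space (mpt (b + sg l) P) (z * f l).
  apply: rr_space_le (rr_spaceM zL (hf l).2) => p; rewrite coeffD /mpt !coeff_point.
  by case: ifP => //; lia.
have [q hq] := choice (fun l => span _ _ (zf l)).
pose M := \matrix_(j < a, l < a) q l j.
pose G := char_poly M.
have G_root : evyz G = 0.
  apply: (ev2_char_poly (f := f) (l0 := Ordinal a_gt0)) => [|l].
    by have [] := hf (Ordinal a_gt0).
  by rewrite (hq l).1; apply: eq_bigr => j _; rewrite mxE.
have G_newton i e : G`_i`_e != 0 -> (a * e + b * i <= a * b)%N.
  move=> h; have := @newton_char_poly _ (- a%:Z) (- b%:Z) a M (fun l => (sg l)%:Z) _ i e h.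
  have wt j l e' : (M j l)`_e' != 0 -> - b%:Z + (sg j)%:Z <= - a%:Z * e'%:Z + (sg l)%:Z.
    by rewrite mxE => /(hq l).2; lia.
  by move=> /(_ wt); lia.
have G_monic : G \is monic by exact: char_poly_monic.
have size_G : size G = a.+1 by exact: size_char_poly.
exists G; split=> //; apply/eqP => Gb0.
have Ga : G`_a = 1 by move/monicP: G_monic; rewrite lead_coefE size_G.
move: G_root; rewrite (@ev2E_wide _ _ _ a.+1) ?size_G // big_ord_recr /= Ga rmorph1 mul1r.
have za0 : z ^+ a != 0 by rewrite expf_neq0.
have vza : ord P (z ^+ a) = - (a * b)%N%:Z.
  by rewrite (valX (ord_valuation P)) // ord_z -mulr_natl natz; lia.
(* Without Y^b the term z^a would dominate: a monomial y^e z^i with i < a and order -ab needs a to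
   divide bi, so i = 0 and e = b. *)
rewrite addrC => /eqP; apply/negP.
apply: (proj1 (valD (ord_valuation P) za0 _)).
apply: (vge_sum (ord_valuation P)) => i _; rewrite vza.
have -> : - (a * b)%N%:Z + 1 = (- (a * b)%N%:Z + 1 + (b * i)%N%:Z) + - (b * i)%N%:Z by lia.
apply: (vgeM (ord_valuation P)); last first.
  rewrite vge_neq0 ?expf_neq0 // (valX (ord_valuation P)) // ord_z.
  by rewrite -mulr_natl natz; lia.
apply: (vge_ev (ord_valuation P) (@ord_cst R X P)) => // e Gie; rewrite ord_y.
have := G_newton _ _ Gie.
have [e_eq|] := eqVneq (a * e + b * i)%N (a * b)%N; last by lia.
have : (a %| b * i)%N by rewrite -(dvdn_addr _ (dvdn_mulr e (dvdnn a))) e_eq dvdn_mulr.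
rewrite Gauss_dvdr // => /dvdnP [[|k] ik]; last by have := ltn_ord i; rewrite ik; nia.
have eb : e = b by nia.
by move: Gie; rewrite ik eb mul0n Gb0 eqxx.
Qed.

Section AtZero.
Variable Q : cpoint X.
Hypothesis PQ : P != Q.
Hypothesis div_y : forall p, coeff p (mpt a Q) = coeff p (mpt a P) + ord p y.

Lemma rr_space_y_pole : rr_space (mpt a P) y.
Proof.
right=> p; rewrite -div_y /mpt coeff_point; by case: ifP.
Qed.

Lemma newton_polygon_zero (k : nat) :
  regular_off P z -> ord Q z = k%:Z -> (0 < k)%N ->
  exists G : {poly {poly R[i]}}, [/\ G \is monic, size G = a.+1, evyz G = 0,
    forall i e, G`_i`_e != 0 -> (a * k <= a * e + k * i)%N & G`_0`_k != 0].
Proof.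
move=> z_reg ordQz k_gt0.
have valQ := ord_valuation Q.
have ordQy : ord Q y = a%:Z by apply: ord_yQ PQ div_y.
have y_reg : regular_off P y by exists a; exact: rr_space_y_pole.
have [f [hf span]] := two_point_basis genus_X a_gt0 y_neq0 PQ div_y.
(* Stated for any w because it is applied both to z and to the cofactor G_0(y)/z. The condition
   [0 <= ka] keeps the pole of w f_l at Q below order a, where the basis spans. *)
have mul_matrix (w : X) (ka : int) : regular_off P w -> vge (ord Q) ka w -> 0 <= ka ->
    exists M : 'M[{poly R[i]}]_a, (forall l, w * f l = \sum_j evy (M j l) * f j) /\
      (forall j l e, (M j l)`_e != 0 -> ka + j%:Z <= a%:Z * e%:Z + l%:Z).
  move=> [B wB] wQ ka_ge0.
  have wf (l : 'I_a) : exists m, rr_space (<< m *g P >> + << l%:Z - ka *g Q >>) (w * f l).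
    have [_ _ [m fm]] := hf l; exists (B%:Z + m); apply/rr_spaceP => p.
    have [Qp|Qp] := eqVneq Q p.
      rewrite -Qp coeffD !coeff_point eqxx (negbTE PQ) add0r opprB.
      apply: vgeM => //; move/rr_spaceP: fm => /(_ Q).
      by rewrite coeffD !coeff_point eqxx (negbTE PQ) add0r.
    move/rr_spaceP: (rr_spaceM wB fm) => /(_ p).
    rewrite !coeffD /mpt !coeff_point (negbTE Qp) !addr0.
    by case: ifP => _; rewrite ?addr0.
  have [m hm] := choice wf.
  have ltl (l : 'I_a) : l%:Z - ka < a%:Z by have := ltn_ord l; lia.
  have [q hq] := choice (fun l => span _ _ _ (ltl l) (hm l)).
  exists (\matrix_(j, l) q l j); split=> [l|j l e].
    by rewrite (hq l).1; apply: eq_bigr => j _; rewrite mxE.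
  by rewrite mxE => /(hq l).2; lia.
have zQ : vge (ord Q) k%:Z z by rewrite vge_neq0 // ordQz.
have [M [Mz M_wt]] := mul_matrix z k%:Z z_reg zQ isT.
pose G := char_poly M.
have G_root : evyz G = 0.
  apply: (ev2_char_poly (f := f) (l0 := Ordinal a_gt0)) => //.
  by have [] := hf (Ordinal a_gt0).
have G_newton i e : G`_i`_e != 0 -> (a * k <= a * e + k * i)%N.
  by move=> h; have := newton_char_poly M_wt h; lia.
have G_monic : G \is monic by exact: char_poly_monic.
have size_G : size G = a.+1 by exact: size_char_poly.
exists G; split=> //.
pose G1 := drop_poly 1 G.
have GE : G = G1 * 'X + (G`_0)%:P.
  rewrite -[LHS](poly_take_drop 1) expr1 addrC; congr (_ + _).
  by apply/polyP => i; rewrite coef_take_poly coefC; case: i.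
(* G1 has degree a - 1 in Z, below the least degree of a relation. *)
have G1_0 : evyz G1 != 0.
  have G1_neq0 : G1 != 0.
    by rewrite -size_poly_eq0 size_drop_poly size_G subn1 -lt0n.
  apply/eqP => /(ev2_root_size G1_neq0).
  by rewrite size_drop_poly size_G subn1 ltnn.
have G0E : evy G`_0 = z * - evyz G1.
  have : evyz (G1 * 'X + (G`_0)%:P) = 0 by rewrite -GE.
  rewrite rmorphD rmorphM /= ev2X ev2C => /eqP.
  by rewrite addrC addr_eq0 => /eqP ->; rewrite mulrN mulrC.
pose w := - evyz G1.
have w0 : w != 0 by rewrite oppr_eq0.
have w_reg : regular_off P w.
  rewrite /w -mulN1r -(rmorph1 (cst X)) -(rmorphN (cst X)).
  by apply: regular_offM; [exact: regular_off_cst | exact: regular_off_ev2].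
have G00 : G`_0 != 0.
  apply/eqP => G00; move: G0E; rewrite G00 rmorph0 => /esym/eqP.
  by rewrite mulf_eq0 (negbTE z_neq0) (negbTE w0).
have vy0 : ord Q y != 0 by rewrite ordQy; clear -a_gt0; lia.
have [evG0 [e0 Ge0 vG0]] := val_ev valQ (@ord_cst R X Q) y_neq0 vy0 G00.
have e0_ge : (k <= e0)%N by have h := G_newton 0%N e0 Ge0; clear -h a_gt0; nia.
suff le : (e0 <= k)%N.
  by have <- : e0 = k by [apply/eqP; rewrite eqn_leq le e0_ge].
have vw : ord Q w = a%:Z * e0%:Z - k%:Z.
  by move: vG0; rewrite G0E -/w valM // ordQz ordQy => <-; rewrite [k%:Z + _]addrC addrK.
have vw_ge0 : 0 <= a%:Z * e0%:Z - k%:Z by clear -e0_ge a_gt0; nia.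
have wQ : vge (ord Q) (a%:Z * e0%:Z - k%:Z) w by rewrite vge_neq0 // vw.
have [W [Ww W_wt]] := mul_matrix w _ w_reg wQ vw_ge0.
(* Both matrices describe multiplication by z w = G_0(y), and coordinates over C[y] are unique
   because the orders at Q of the y^e f_l are distinct. *)
have WM : W *m M = (G`_0)%:M.
  apply/matrixP => i l; apply/eqP; rewrite -subr_eq0; apply/eqP.
  pose d i := (W *m M) i l - (G`_0)%:M i l; rewrite -/(d i); move: i.
  apply: (ev_indep valQ (@ord_cst R X Q) (y := y) (f := f)) => //.
  - by move=> j; have [] := hf j.
  - move=> j j' e e'; have [_ -> _] := hf j; have [_ -> _] := hf j'.
    rewrite ordQy => h; have : (a * e + j' = a * e' + j)%N by clear -h; lia.
    move/(congr1 (modn^~ a)); rewrite ![(a * _)%N]mulnC !modnMDl !modn_small //.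
    by move=> h'; apply: val_inj.
  rewrite /d; under eq_bigr => i _ do rewrite rmorphB mulrBl.
  apply/eqP; rewrite sumrB subr_eq0; apply/eqP.
  transitivity (w * (z * f l)).
    rewrite Mz mulr_sumr; under [RHS]eq_bigr => j _ do rewrite mulrCA Ww mulr_sumr.
    rewrite exchange_big; apply: eq_bigr => i _; rewrite !mxE rmorph_sum mulr_suml.
    by apply: eq_bigr => j _; rewrite rmorphM /= mulrA [evy (W i j) * _]mulrC.
  rewrite (bigD1 l) //= !mxE eqxx mulr1n big1 ?addr0 => [|i /negbTE il].
    by rewrite G0E mulrA [w * z]mulrC.
  by rewrite !mxE il mulr0n rmorph0 mul0r.
have detW0 : \det W != 0.
  apply/eqP => dW; move: (congr1 determinant WM); rewrite det_mulmx dW mul0r det_scalar.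
  by move/esym/eqP; rewrite expf_eq0 (negbTE G00) andbF.
have [evW [e1 We1 vW]] := val_ev valQ (@ord_cst R X Q) y_neq0 vy0 detW0.
have e1_ge := newton_det W_wt We1.
(* det M is G_0 up to sign. At Q this reads e1 + e0 = a e0 after division by a, and the bound e1 >=
   a e0 - k for det W yields e0 <= k. *)
have detM : \det W * ((-1) ^+ a * G`_0) = G`_0 ^+ a.
  by rewrite [X in _ ^+ a * X]char_poly_det signrMK -det_mulmx WM det_scalar.
have := congr1 (fun p => ord Q (evy p)) detM.
have sgn_val : ord Q ((-1) ^+ a : X) = 0.
  by rewrite (valX valQ) ?oppr_eq0 ?oner_eq0 // valN // val1 // mul0rn.
have sgn0 : (-1) ^+ a != 0 :> X by rewrite expf_neq0 // oppr_eq0 oner_eq0.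
rewrite !rmorphM !rmorphXn rmorphN rmorph1 /=.
rewrite (valM valQ) ?mulf_neq0 // (valM valQ) // sgn_val add0r (valX valQ) //.
rewrite vG0 vW ordQy -mulr_natl natz => hv.
have : a%:Z * e0%:Z <= a%:Z * k%:Z by clear -hv e1_ge; lia.
by rewrite ler_pM2l.
Qed.

End AtZero.
End NewtonPolygons.

(** * Order of vanishing of multivariate polynomials *)

Section Vanishing.
Local Open Scope ring_scope.
Variables (k : nat) (F : fieldType).
Implicit Types (p q : {mpoly F[k]}) (x : 'I_k -> F) (E : 'M[F]_k).

Lemma mpoly_ring_ind (S : {mpoly F[k]} -> Prop) :
  (forall c, S c%:MP) -> (forall i, S 'X_i) ->
  (forall p q, S p -> S q -> S (p + q)) ->
  (forall p q, S p -> S q -> S (p * q)) -> forall p, S p.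
Proof.
move=> SC SX SD SM p; rewrite [p]mpolyE.
elim/big_ind: _ => [||m _]; [by rewrite -mpolyC0 | exact: (SD) | ].
rewrite -mul_mpolyC mpolyXE_id; apply: (SM) => //.
elim/big_ind: _ => [||i _]; [by rewrite -mpolyC1 | exact: (SM) | ].
by elim: (m i) => [|n IH]; rewrite ?expr0 -?mpolyC1 // exprS; apply: (SM).
Qed.

Definition vanish (n : nat) x p : Prop :=
  forall m : 'X_{1..k}, (mdeg m < n)%N -> p^`M[m].@[x] = 0.

(** Reduces the order of vanishing to first derivatives, so that the chain rule and induction give
    its invariance under linear substitutions. *)
Lemma vanishS n x p :
  vanish n.+1 x p <-> p.@[x] = 0 /\ forall i, vanish n x p^`M(i).
Proof.
split=> [h|[h0 h] m lt].
  split=> [|i m lt]; first by have := h 0%MM; rewrite mderivm0m mdeg0; apply.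
  by have := h (U_(i) + m)%MM; rewrite mdegD mdeg1 mderivmDm mderivmU1m; apply.
have [/eqP|m_gt0] := posnP (mdeg m).
  by rewrite mdeg_eq0 => /eqP ->; rewrite mderivm0m.
have [i mi] : exists i, (0 < m i)%N.
  apply/existsP; apply: contraT; rewrite negb_exists => /forallP m0.
  move: m_gt0; rewrite mdegE big1 // => i _; apply/eqP.
  by have := m0 i; rewrite lt0n negbK.
have mE : m = (U_(i) + (m - U_(i)))%MM.
  rewrite addmC submK //; apply/mnm_lepP => j; rewrite mnm1E.
  by case: eqP => [<-|].
rewrite mE mderivmDm mderivmU1m; apply: h.
by move: lt; rewrite [X in mdeg X]mE mdegD mdeg1.
Qed.

Lemma vanish_sum (I : Type) (r : seq I) n x (G : I -> {mpoly F[k]}) :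
  (forall i, vanish n x (G i)) -> vanish n x (\sum_(i <- r) G i).
Proof.
move=> h m lt; rewrite !raddf_sum /= big1 // => i _; exact: h.
Qed.

Lemma vanishZ n x c p : vanish n x p -> vanish n x (c *: p).
Proof. by move=> h m lt; rewrite mderivmZ mevalZ h // mulr0. Qed.

(** Row-vector convention: the value at x is p(xE), so the j-th coordinate point is sent to row j of
    E. *)
Definition lin_subst E p : {mpoly F[k]} := p \mPo [tuple \sum_j E j i *: 'X_j | i < k].

Lemma lin_substD E p q : lin_subst E (p + q) = lin_subst E p + lin_subst E q.
Proof. exact: comp_mpolyD. Qed.

Lemma lin_substM E p q : lin_subst E (p * q) = lin_subst E p * lin_subst E q.
Proof. exact: rmorphM. Qed.

Lemma lin_substC E c : lin_subst E c%:MP = c%:MP.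
Proof. exact: comp_mpolyC. Qed.

Lemma lin_substX E i : lin_subst E 'X_i = \sum_j E j i *: 'X_j.
Proof. by rewrite /lin_subst comp_mpolyXU -tnth_nth tnth_mktuple. Qed.

Lemma mderivXU l j : ('X_l : {mpoly F[k]})^`M(j) = ((l == j)%:R)%:MP.
Proof.
rewrite mderivX mnm1E; case: eqP => [->|_]; last by rewrite scale0r mpolyC0.
by rewrite scale1r -[U_(j)%MM in X in (X - _)%MM]add0m addmK mpolyX0 mpolyC1.
Qed.

Lemma mderiv_lin_subst E p j :
  (lin_subst E p)^`M(j) = \sum_i E j i *: lin_subst E p^`M(i).
Proof.
elim/mpoly_ring_ind: p => [c|i|p q IHp IHq|p q IHp IHq].
- rewrite lin_substC mderivC big1 // => i _.
  by rewrite mderivC -mpolyC0 lin_substC mpolyC0 scaler0.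
- rewrite lin_substX raddf_sum /= (bigD1 j) //= [in RHS](bigD1 i) //=.
  rewrite mderivZ !mderivXU !eqxx lin_substC !big1 ?addr0 // => l /negbTE li.
    by rewrite mderivXU eq_sym li lin_substC scaler0.
  by rewrite mderivZ mderivXU li scaler0.
- rewrite lin_substD mderivD IHp IHq -big_split; apply: eq_bigr => i _ /=.
  by rewrite mderivD lin_substD scalerDr.
rewrite lin_substM mderivM IHp IHq mulr_suml mulr_sumr -big_split.
apply: eq_bigr => i _ /=; rewrite mderivM lin_substD !lin_substM scalerDr.
by rewrite scalerAl scalerAr.
Qed.

Lemma meval_lin_subst E p x :
  (lin_subst E p).@[x] = p.@[fun i => \sum_j x j * E j i].
Proof.
rewrite comp_mpoly_meval; apply: meval_eq => i.
rewrite tnth_mktuple raddf_sum /=; apply: eq_bigr => j _.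
by rewrite mevalZ mevalXU mulrC.
Qed.

Lemma vanish_lin_subst n E p x :
  vanish n (fun i => \sum_j x j * E j i) p -> vanish n x (lin_subst E p).
Proof.
elim: n p => [//|n IH] p /vanishS [p0 hp]; apply/vanishS.
rewrite meval_lin_subst; split=> // j; rewrite mderiv_lin_subst.
by apply: vanish_sum => i; apply/vanishZ/IH.
Qed.

Lemma lin_substK E E' : E' *m E = 1%:M -> cancel (lin_subst E) (lin_subst E').
Proof.
move=> EE'; elim/mpoly_ring_ind => [c|i|p q IHp IHq|p q IHp IHq].
- by rewrite !lin_substC.
- rewrite lin_substX /lin_subst !linear_sum /=.
  under eq_bigr => j _ do rewrite comp_mpolyZ -/(lin_subst _ _) lin_substX scaler_sumr.
  rewrite exchange_big /= (bigD1 i) //= [X in _ + X]big1 ?addr0 => [|l li].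
    under eq_bigr => j _ do rewrite scalerA mulrC.
    rewrite -scaler_suml; have := congr1 (fun M : 'M_k => M i i) EE'.
    by rewrite !mxE eqxx => ->; rewrite scale1r.
  under eq_bigr => j _ do rewrite scalerA mulrC.
  rewrite -scaler_suml; have := congr1 (fun M : 'M_k => M l i) EE'.
  by rewrite !mxE (negbTE li) => ->; rewrite scale0r.
- by rewrite !lin_substD IHp IHq.
by rewrite !lin_substM IHp IHq.
Qed.

Lemma dhomog_prod_sum (I : finType) (w : I -> nat) (G : I -> {mpoly F[k]}) :
  (forall i, G i \is (w i).-homog) -> \prod_i G i \is (\sum_i w i)%N.-homog.
Proof.
move=> h; elim/big_rec2: _ => [|i n p _ IH]; first exact: dhomog1.
exact: dhomogM.
Qed.

Lemma dhomog_lin_subst d E p : p \is d.-homog -> lin_subst E p \is d.-homog.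
Proof.
move=> /dhomogP hp; rewrite /lin_subst comp_mpolyEX big_seq; apply: rpred_sum => m m_in.
apply: dhomogZ; rewrite comp_mpolyX -(hp _ m_in) /= mdegE.
apply: dhomog_prod_sum => i; rewrite -[X in X.-homog]mul1n; apply: dhomogMn.
rewrite tnth_mktuple; apply: rpred_sum => j _; apply: dhomogZ.
by rewrite dhomogX /= mdeg1.
Qed.

Lemma lin_subst_scale d c E p :
  p \is d.-homog -> lin_subst (c *: E) p = c ^+ d *: lin_subst E p.
Proof.
have linE i : \sum_j (c *: E) j i *: 'X_j = c *: \sum_j E j i *: 'X_j :> {mpoly F[k]}.
  by rewrite scaler_sumr; apply: eq_bigr => j _; rewrite mxE scalerA.
move=> /dhomogP hp; rewrite /lin_subst !comp_mpolyEX scaler_sumr !big_seq.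
apply: eq_bigr => m m_in; rewrite !comp_mpolyX -(hp _ m_in) /= mdegE -prodrXr.
rewrite scalerA mulrC -scalerA -scaler_prod; congr (_ *: _); apply: eq_bigr => l _.
by rewrite !tnth_mktuple linE exprZn.
Qed.

Definition unit_vec (j : 'I_k) : 'I_k -> F := fun i => (i == j)%:R.

Lemma prod_unit_vec j (m : 'X_{1..k}) :
  \prod_i unit_vec j i ^+ m i = (m == (U_(j) *+ m j)%MM)%:R.
Proof.
have [mE|/eqP mE] := eqVneq m.
  rewrite big1 // => i _; rewrite /unit_vec.
  case: eqP => [_|/eqP ij]; first by rewrite expr1n.
  by rewrite mE mulmnE mnm1E eq_sym (negbTE ij) mul0n expr0.
have [i [ij mi]] : exists i, i != j /\ m i != 0%N.
  apply: contrapT => h; apply: mE; apply/mnmP => i; rewrite mulmnE mnm1E.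
  case: eqP => [->|/eqP ji]; first by rewrite mul1n.
  rewrite mul0n; apply/eqP; apply: contrapT => /negP mi.
  by apply: h; exists i; rewrite eq_sym.
by rewrite (bigD1 i) //= /unit_vec (negbTE ij) expr0n (negbTE mi) mul0r.
Qed.

(** At a coordinate point only pure powers of X_j survive evaluation. Differentiating along the part
    of a monomial free of X_j therefore isolates its coefficient, up to a factor that is nonzero in
    characteristic 0. *)
Lemma vanish_unit_vec n d j p : [pchar F] =i pred0 -> p \is d.-homog ->
  vanish n (unit_vec j) p <-> forall m, m \in msupp p -> (n + m j <= d)%N.
Proof.
move=> char0 /dhomogP hp; split=> [h m m_in|h m' lt].
  have dm : mdeg m = d := hp _ m_in.
  rewrite leqNgt; apply/negP => lt.
  pose m' := [multinom if i == j then 0%N else m i | i < k].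
  pose t := (U_(j) *+ m j)%MM.
  have mE : m = (m' + t)%MM.
    apply/mnmP => i; rewrite mnmDE mulmnE mnm1E mnmE eq_sym.
    by case: eqP => [->|_]; rewrite ?mul1n // mul0n addn0.
  have dm' : (mdeg m' + m j)%N = d by rewrite -dm [in RHS]mE mdegD mdegMn mdeg1 mul1n.
  have lt' : (mdeg m' < n)%N by lia.
  have := h m' lt'; rewrite mevalE => /eqP; apply/negP.
  have coef_t : p^`M[m']@_t != 0.
    rewrite mcoeff_mderivm -mE -mulr_natr mulf_neq0 ?mcoeff_msupp //.
      by rewrite -mcoeff_msupp.
    rewrite ((pcharf0P F).1 char0) -lt0n; apply: prodn_gt0 => i.
    by rewrite ffact_gt0 mE mnmDE leq_addr.
  rewrite (bigD1_seq t) ?msupp_uniq ?mcoeff_msupp //= [X in _ + X]big1 ?addr0 => [|m'' ne].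
    by rewrite prod_unit_vec mulmnE mnm1E eqxx mul1n eqxx mulr1.
  rewrite prod_unit_vec; case: eqP => [m''E|_]; last by rewrite mulr0.
  rewrite mulr1 mcoeff_mderivm.
  have [->|pm] := eqVneq p@_(m' + m'') 0; first by rewrite mul0rn.
  have := hp (m' + m'')%MM; rewrite mcoeff_msupp => /(_ pm) /=.
  rewrite mdegD m''E mdegMn mdeg1 mul1n => dm''.
  by move: ne; rewrite m''E /t (_ : m'' j = m j) ?eqxx //; lia.
rewrite mevalE big1 // => m'' _; rewrite prod_unit_vec.
case: eqP => [m''E|_]; last by rewrite mulr0.
rewrite mulr1 mcoeff_mderivm.
have [->|pm] := eqVneq p@_(m' + m'') 0; first by rewrite mul0rn.
have pm' : (m' + m'')%MM \in msupp p by rewrite mcoeff_msupp.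
have := h _ pm'; have := hp _ pm'; rewrite /= mdegD m''E mdegMn mdeg1 mul1n mnmDE.
by rewrite mulmnE mnm1E eqxx; lia.
Qed.

End Vanishing.

(** * Dehomogenization *)

Section Dehomogenization.
Local Open Scope ring_scope.
Variables (F K : fieldType) (iota : {rmorphism F -> K}).
Implicit Types (p q : {mpoly F[3]}) (G : {poly {poly F}}).

Let o0 : 'I_3 := ord0.
Let o1 : 'I_3 := Ordinal (isT : 1 < 3)%N.
Let o2 : 'I_3 := Ordinal (isT : 2 < 3)%N.

Lemma ord3_sum (T : nmodType) (h : 'I_3 -> T) : \sum_i h i = h o0 + h o1 + h o2.
Proof.
rewrite !big_ord_recl big_ord0 addr0 addrA; congr (_ + h _ + h _); exact: val_inj.
Qed.

Lemma ord3_prod (T : comPzSemiRingType) (h : 'I_3 -> T) :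
  \prod_i h i = h o0 * h o1 * h o2.
Proof.
rewrite !big_ord_recl big_ord0 mulr1 mulrA; congr (_ * h _ * h _); exact: val_inj.
Qed.

Lemma mdeg3 (m : 'X_{1..3}) : mdeg m = (m o0 + m o1 + m o2)%N.
Proof. by rewrite mdegE (ord3_sum (T := nat)). Qed.

Definition dehom_var (i : 'I_3) : {poly {poly F}} := nth 0 [:: 1; 'X%:P; 'X] i.

Definition dehom p : {poly {poly F}} :=
  mmap (polyC \o polyC) dehom_var p.

Lemma dehomM p q : dehom (p * q) = dehom p * dehom q.
Proof.
rewrite /dehom; have [morM _] := mmap_is_multiplicative dehom_var
  (polyC \o polyC : {rmorphism F -> {poly {poly F}}}).
by rewrite morM.
Qed.

Lemma dehomX (m : 'X_{1..3}) : dehom 'X_[m] = ('X^(m o1))%:P * 'X^(m o2).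
Proof.
rewrite /dehom mmapX /mmap1 ord3_prod /dehom_var /= expr1n mul1r.
by rewrite -polyC_exp.
Qed.

Lemma dehomE p :
  dehom p = \sum_(m <- msupp p) (p@_m *: 'X^(m o1))%:P * 'X^(m o2).
Proof.
rewrite [in LHS](mpolyE p) /dehom raddf_sum /=; apply: eq_bigr => m _.
by rewrite mmapZ -/(dehom _) dehomX /= -mul_polyC polyCM mulrA.
Qed.

Lemma coef_dehom p i e :
  (dehom p)`_i`_e = \sum_(m <- msupp p) p@_m * ((m o1 == e) && (m o2 == i))%:R.
Proof.
rewrite dehomE !coef_sum; apply: eq_bigr => m _.
rewrite coefCM coefXn [m o2 == i]eq_sym [m o1 == e]eq_sym.
case: (i == _); rewrite ?mulr1 ?mulr0 ?andbT ?andbF ?coef0 ?mulr0 //.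
by rewrite coefZ coefXn.
Qed.

Lemma coef_dehom_neq0 p i e : (dehom p)`_i`_e != 0 ->
  exists2 m, m \in msupp p & m o1 = e /\ m o2 = i.
Proof.
rewrite coef_dehom => h; apply: contrapT => none; case/eqP: h.
rewrite big_seq big1 // => m m_in; case: andP => [[/eqP h1 /eqP h2]|_].
  by case: none; exists m.
by rewrite mulr0.
Qed.

(** In a fixed degree the exponent of X_0 is determined by the other two, so no two monomials
    merge. *)
Lemma coef_dehom_msupp d p m : p \is d.-homog -> m \in msupp p ->
  (dehom p)`_(m o2)`_(m o1) = p@_m.
Proof.
move=> /dhomogP hp m_in; rewrite coef_dehom (bigD1_seq m) ?msupp_uniq //= !eqxx mulr1.
rewrite big_seq_cond big1 ?addr0 // => m' /andP [m'_in ne].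
case: andP => [[/eqP h1 /eqP h2]|_]; last by rewrite mulr0.
have := hp _ m_in; rewrite -(hp _ m'_in) /= !mdeg3 h1 h2 => h0.
case/eqP: ne; apply/mnmP => i.
have : (i == o0) || (i == o1) || (i == o2) by case: i => [[|[|[]]]].
by case/orP => [/orP [] | ] /eqP -> //; lia.
Qed.

Lemma mmap_dehom d p (u : 'I_3 -> K) : p \is d.-homog -> u o0 != 0 ->
  mmap iota u p = u o0 ^+ d * ev2 iota (u o1 / u o0) (u o2 / u o0) (dehom p).
Proof.
move=> /dhomogP hp u0; rewrite dehomE raddf_sum /= mulr_sumr.
rewrite /mmap big_seq [RHS]big_seq; apply: eq_bigr => m m_in.
rewrite rmorphM rmorphXn /= ev2X ev2C -mul_polyC rmorphM rmorphXn /= evC evX.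
rewrite /mmap1 ord3_prod !expr_div_n -(hp _ m_in) /= mdeg3 !exprD.
have h (n : nat) : u o0 ^+ n != 0 by rewrite expf_neq0.
move: (h (m o0)) (h (m o1)) (h (m o2)) => h0 h1 h2; field.
by rewrite h1 h2.
Qed.

(** The truncated subtraction is harmless: [hom] is applied only when nonzero coefficients have i +
    e <= N. *)
Definition mon3 N i e : 'X_{1..3} :=
  [multinom nth 0%N [:: N - i - e; e; i] j | j < 3].

Definition hom N G : {mpoly F[3]} :=
  \sum_(i < N.+1) \sum_(e < N.+1) G`_i`_e *: 'X_[mon3 N i e].

Lemma dhomog_hom N G : (forall i e, G`_i`_e != 0 -> (i + e <= N)%N) ->
  hom N G \is N.-homog.
Proof.
move=> hG; apply: rpred_sum => i _; apply: rpred_sum => e _.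
have [->|Gie] := eqVneq G`_i`_e 0; first by rewrite scale0r dhomog0.
by apply: dhomogZ; rewrite dhomogX /= mdeg3 !mnmE /=; have := hG _ _ Gie; lia.
Qed.

Lemma poly_coef_wide (T : nzRingType) n (p : {poly T}) :
  (forall i, p`_i != 0 -> (i < n)%N) -> p = \sum_(i < n) p`_i *: 'X^i.
Proof.
move=> hp; rewrite -poly_def; apply/polyP => i; rewrite coef_poly.
by case: ltnP => // ni; apply/eqP; apply: contraTT ni => /hp; rewrite -ltnNge.
Qed.

Lemma hom_dehom N G : (forall i e, G`_i`_e != 0 -> (i + e <= N)%N) ->
  dehom (hom N G) = G.
Proof.
move=> hG; rewrite /hom /dehom !raddf_sum /=.
rewrite [RHS](@poly_coef_wide _ N.+1) => [|i Gi].
  apply: eq_bigr => i _; rewrite raddf_sum /=.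
  rewrite [in RHS](@poly_coef_wide _ N.+1 G`_i) => [|e /hG]; last by lia.
  rewrite -mul_polyC raddf_sum mulr_suml; apply: eq_bigr => e _ /=.
  rewrite mmapZ -/(dehom _) dehomX /= !mnmE /=.
  by rewrite -mul_polyC polyCM mulrA.
have /hG : G`_i`_(size G`_i).-1 != 0 by rewrite -lead_coefE lead_coef_eq0.
by lia.
Qed.

Lemma mmap_lin_subst (E : 'M[F]_3) (u : 'I_3 -> K) p :
  mmap iota u (lin_subst E p) = mmap iota (fun i => \sum_j u j * iota (E j i)) p.
Proof.
elim/mpoly_ring_ind: p => [c|i|p q IHp IHq|p q IHp IHq].
- by rewrite lin_substC !mmapC.
- rewrite lin_substX mmapX mmap1U raddf_sum /=; apply: eq_bigr => j _.
  by rewrite mmapZ mmapX mmap1U mulrC.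
- by rewrite lin_substD !mmapD IHp IHq.
by rewrite lin_substM !rmorphM /= IHp IHq.
Qed.

End Dehomogenization.

(** * The equation of the plane model in adapted coordinates *)

Section PlaneSupport.
Local Open Scope ring_scope.
Variables (R : realType) (X : curve R).
Variables (s u : 'I_3 -> X) (F : {mpoly R[i][3]}) (d : nat) (E E' : 'M[R[i]]_3).
Hypotheses (equation : plane_equation s F) (F_homog : F \is d.-homog).
Hypotheses (sE : forall i, s i = \sum_j u j * cst X (E j i)).
Hypotheses (uE : forall i, u i = \sum_j s j * cst X (E' j i)).
Hypotheses (EE' : E *m E' = 1%:M) (E'E : E' *m E = 1%:M).

Let o0 : 'I_3 := ord0.
Let o1 : 'I_3 := Ordinal (isT : 1 < 3)%N.
Let o2 : 'I_3 := Ordinal (isT : 2 < 3)%N.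
Hypothesis u0 : u o0 != 0.
Local Notation y := (u o1 / u o0).
Local Notation z := (u o2 / u o0).
Local Notation F' := (lin_subst E F).

Lemma evalK_ext (w w' : 'I_3 -> X) p : (forall i, w i = w' i) ->
  evalK (cst X) w p = evalK (cst X) w' p.
Proof. by move=> h; rewrite (_ : w = w') //; apply/funext. Qed.

Lemma dehom_root : ev2 (cst X) y z (dehom F') = 0.
Proof.
have : evalK (cst X) u F' = 0.
  rewrite /evalK mmap_lin_subst -/(evalK _ _ _) -(@evalK_ext s) //.
  by apply/(equation.2 d) => //; exists 1; rewrite mul1r.
rewrite /evalK (mmap_dehom _ (dhomog_lin_subst E F_homog)) // => /eqP.
by rewrite mulf_eq0 expf_eq0 (negbTE u0) andbF => /eqP.
Qed.

(** Homogenize G in the coordinates u and pull it back to s: the resulting form vanishes on the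
    curve, hence is a multiple of F. *)
Lemma dehom_dvd N (G : {poly {poly R[i]}}) :
  (forall i e, G`_i`_e != 0 -> (i + e <= N)%N) -> ev2 (cst X) y z G = 0 ->
  exists H, G = dehom H * dehom F'.
Proof.
move=> hG G_root.
have hom_h := dhomog_hom hG.
have : evalK (cst X) s (lin_subst E' (hom N G)) = 0.
  rewrite /evalK mmap_lin_subst -/(evalK _ _ _) -(@evalK_ext u) //.
  by rewrite /evalK (mmap_dehom _ hom_h) // hom_dehom // G_root mulr0.
move/(equation.2 _ _ (dhomog_lin_subst E' hom_h)) => [H HE].
exists (lin_subst E H).
by rewrite -dehomM -lin_substM -HE (lin_substK EE') hom_dehom.
Qed.

(** The equation is itself a relation, so its degree in Z is at least a. The cofactor is then free
    of Z, and as G is monic it divides 1, so it is a constant. *)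
Lemma dehom_scalar (a N : nat) (G : {poly {poly R[i]}}) :
  (forall i e, G`_i`_e != 0 -> (i + e <= N)%N) -> ev2 (cst X) y z G = 0 ->
  G \is monic -> size G = a.+1 ->
  (forall q, q != 0 -> ev2 (cst X) y z q = 0 -> (a < size q)%N) ->
  exists2 c, c != 0 & G = (c%:P)%:P * dehom F'.
Proof.
move=> hG G_root G_monic size_G size_root.
have [H GE] := dehom_dvd hG G_root.
move: (dehom H) GE => h GE.
have G0 : G != 0 by rewrite monic_neq0.
have h0 : h != 0 by apply: contraNneq G0 => h0; rewrite GE h0 mul0r.
have f0 : dehom F' != 0 by apply: contraNneq G0 => f0; rewrite GE f0 mulr0.
have := size_root _ f0 dehom_root.
have := size_mul h0 f0; rewrite -GE size_G => size_E lt.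
have /size_poly1P [h1 h10 hE] : size h == 1%N.
  apply/eqP; move: size_E lt h0; rewrite -size_poly_gt0.
  by move: (size h) (size (dehom F')) => sh sf; lia.
have : lead_coef G = h1 * lead_coef (dehom F') by rewrite GE lead_coefM hE lead_coefC.
rewrite (monicP G_monic) => h1E.
have l0 : lead_coef (dehom F') != 0 by rewrite lead_coef_eq0.
move: (lead_coef _) l0 h1E => l l0 h1E.
have /size_poly1P [c c0 cE] : size h1 == 1%N.
  have := congr1 (fun p : {poly R[i]} => size p) h1E.
  rewrite size_poly1 size_mul //; move: h10 l0; rewrite -!size_poly_gt0.
  by move: (size h1) (size l) => sh sl; lia.
by exists c => //; rewrite GE hE cE.
Qed.

Lemma degree_le N (G : {poly {poly R[i]}}) :
  (forall i e, G`_i`_e != 0 -> (i + e <= N)%N) -> ev2 (cst X) y z G = 0 ->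
  G != 0 -> (d <= N)%N.
Proof.
move=> hG G_root G0.
have hom_h := dhomog_hom hG.
have : evalK (cst X) s (lin_subst E' (hom N G)) = 0.
  rewrite /evalK mmap_lin_subst -/(evalK _ _ _) -(@evalK_ext u) //.
  by rewrite /evalK (mmap_dehom _ hom_h) // hom_dehom // G_root mulr0.
move/(equation.2 _ _ (dhomog_lin_subst E' hom_h)) => [H HE].
have h0 : lin_subst E' (hom N G) != 0.
  apply: contraNneq G0 => e; rewrite -(hom_dehom hG) -(lin_substK EE' (hom N G)) e.
  by rewrite -mpolyC0 lin_substC /dehom mmapC /= !rmorph0.
have size_homog k (p : {mpoly R[i][3]}) : p != 0 -> p \is k.-homog -> msize p = k.+1.
  move=> p0 hp; have := dhomog_uniq p0 (dhomog_msize hp) hp.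
  by rewrite -msize_poly_eq0 in p0; move: p0; case: (msize p) => // n _ /= ->.
have [H0 F0] : H != 0 /\ F != 0.
  by move: h0; rewrite HE mulf_eq0 negb_or => /andP.
have size_H : msize H != 0%N by rewrite msize_poly_eq0.
have size_HF := size_homog _ _ h0 (dhomog_lin_subst E' hom_h).
have := msizeM H0 F0; rewrite (size_homog d F F0 F_homog) -HE size_HF.
by move: size_H; move: (msize H) => sh; lia.
Qed.

End PlaneSupport.

(** * Counting residues *)

Section Counting.
Local Open Scope classical_set_scope.
Local Open Scope nat_scope.
Variables (a b mu : nat).
Hypotheses (a_gt0 : 0 < a) (cop_b : coprime a b) (cop_mu : coprime a mu).
Hypotheses (mu_lt : mu < a) (mu_le : mu <= b).

(** The Apery set of S with respect to a: the subtracted multiple m of a is the largest with ma <= i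
    mu. *)
Definition residue_min (i : nat) : nat := i * b - (i * mu %/ a) * a.

Lemma residue_minE i : residue_min i + (i * mu %/ a) * a = i * b.
Proof.
rewrite /residue_min subnK // (leq_trans (leq_trunc_div _ _)) //.
by rewrite leq_mul2l mu_le orbT.
Qed.

Lemma residue_min_mod i : residue_min i = i * b %[mod a].
Proof. by rewrite -(residue_minE i) addnC modnMDl. Qed.

Lemma coprime_mul_inj c i j : coprime a c -> i < a -> j < a ->
  i * c = j * c %[mod a] -> i = j.
Proof.
move=> cop; wlog le : i j / i <= j.
  move=> W ia ja; case/orP: (leq_total i j) => le h; first exact: W.
  by apply/esym; apply: W.
move=> ia ja /eqP; rewrite eq_sym eqn_mod_dvd ?leq_mul2r ?le ?orbT // -mulnBl.
rewrite Gauss_dvdl // => /dvdn_leq; lia.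
Qed.

Lemma residue_perm c (h : nat -> nat) : coprime a c ->
  \sum_(i < a) h (i * c %% a) = \sum_(i < a) h i.
Proof.
move=> cop; pose p (i : 'I_a) := Ordinal (ltn_pmod (i * c) a_gt0).
have p_inj : injective p.
  by move=> i j [e]; apply/val_inj/(coprime_mul_inj cop (ltn_ord i) (ltn_ord j) e).
by rewrite [RHS](reindex_inj p_inj).
Qed.

Lemma exists_residue k : exists2 i, i < a & i * b = k %[mod a].
Proof.
pose p (i : 'I_a) := Ordinal (ltn_pmod (i * b) a_gt0).
have p_inj : injective p.
  by move=> i j [e]; apply/val_inj/(coprime_mul_inj cop_b (ltn_ord i) (ltn_ord j) e).
have [q _ qK] := injF_bij p_inj.
exists (q (Ordinal (ltn_pmod k a_gt0))) => //.
by have [] := qK (Ordinal (ltn_pmod k a_gt0)).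
Qed.

(** The sum counts the gaps of S class by class. Multiplication by b or mu permutes the residues
    modulo a, so both families of remainders have the sum 0 + ... + (a - 1). *)
Lemma residue_min_sum : 2 * \sum_(i < a) residue_min i %/ a = (a - 1) * (b - mu).
Proof.
set B := \sum_(i < a) _.
pose s := \sum_(i < a) i; pose q := \sum_(i < a) i * mu %/ a * a.
have sE : 2 * s = a * (a - 1).
  rewrite /s -(big_mkord xpredT id) bin2_sum bin2 subn1 mul2n even_halfK // oddM.
  by case: (a) => //= m; rewrite andNb.
have sP c : coprime a c -> \sum_(i < a) i * c %% a = s := residue_perm id.
have h1 : \sum_(i < a) residue_min i + q = s * b.
  rewrite /q -big_split /s big_distrl; apply: eq_bigr => i _; exact: residue_minE.
have h2 : q + s = s * mu.
  rewrite -[X in _ + X](sP mu cop_mu) /q -big_split /s big_distrl.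
  by apply: eq_bigr => i _; rewrite /= -divn_eq.
have h3 : \sum_(i < a) residue_min i = B * a + s.
  rewrite -(sP b cop_b) /B big_distrl -big_split.
  by apply: eq_bigr => i _; rewrite /= -residue_min_mod -divn_eq.
have : a * (2 * B) = a * ((a - 1) * (b - mu)) by nia.
by move/eqP; rewrite eqn_pmul2l // => /eqP.
Qed.

Definition cusp_semigroup : set nat :=
  semigroup2 a b `|` trivial_new_nongaps a b mu.

Lemma residue_min_mem i j : i < a -> cusp_semigroup (residue_min i + a * j).
Proof.
move=> ia; have E := residue_minE i; set q := i * mu %/ a in E.
(* For j >= q the element is (j - q) a + i b. Otherwise it is i b - m a with m = q - j, and n(m) is
   the floor of ma/mu plus 1, which is at most i because ma < i mu. *)
have [qj|jq] := leqP q j; first by left; exists (j - q), i; nia.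
right; have q_le : q * a <= i * mu by exact: leq_trunc_div.
have i_gt0 : 0 < i by move: jq; rewrite /q; case: (i) => //; rewrite mul0n div0n.
have q_lt : q * a < i * mu.
  rewrite ltn_neqAle q_le andbT; apply/eqP => e.
  have : a %| i * mu by rewrite -e dvdn_mull.
  by rewrite Gauss_dvdl // => /dvdn_leq; lia.
have mu_gt0 : 0 < mu by nia.
exists (q - j), i, ((q - j) * a %/ mu).+1.
have m_lt : q - j < mu by nia.
split; [by lia | | | by nia].
- rewrite subn1 /= ltn_ceil // andbT ltn_neqAle leq_trunc_div andbT.
  apply/eqP => e; have : mu %| (q - j) * a by rewrite -e dvdn_mull.
  by rewrite Gauss_dvdl 1?coprime_sym // => /dvdn_leq; lia.
rewrite ltn_divLR // (leq_ltn_trans _ q_lt) ?leq_mul2r ?leq_subr ?orbT //=.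
by lia.
Qed.

(** Below a large multiple of a, S misses exactly g integers. An element of W outside S would leave
    fewer than g gaps. *)
Lemma cusp_semigroup_max (W : set nat) (g : nat) :
  2 * g = (a - 1) * (b - mu) -> cusp_semigroup `<=` W ->
  (exists N0, forall N (ns : seq nat), N0 <= N -> uniq ns ->
     {in ns, forall m, W m /\ m < N} -> size ns + g <= N) ->
  W = cusp_semigroup.
Proof.
move=> gE SW [N0 hN0]; apply/seteqP; split=> // k Wk; apply: contrapT => Sk.
have [i ia ik] := exists_residue k.
have k_lt : k < residue_min i.
  rewrite ltnNge; apply/negP => le; apply: Sk.
  have : a %| k - residue_min i by rewrite -eqn_mod_dvd // residue_min_mod ik.
  case/dvdnP => j kE; rewrite (_ : k = residue_min i + a * j).
    exact: residue_min_mem.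
  by rewrite mulnC -kE subnKC.
pose M := N0 + a * b + k.+1.
pose ns := [seq residue_min i + a * j |
  i <- iota 0 a, j <- iota 0 (M - residue_min i %/ a)].
have min_le j : j < a -> residue_min j %/ a <= M.
  move=> ja; apply: (leq_trans (leq_div _ _)).
  apply: (leq_trans (leq_subr _ _)); have : j * b <= a * b by rewrite leq_mul2r (ltnW ja) orbT.
  rewrite /M; lia.
have same i1 i2 j1 j2 : i1 < a -> i2 < a ->
    residue_min i1 + a * j1 = residue_min i2 + a * j2 -> i1 = i2.
  move=> h1 h2 /(congr1 (modn^~ a)); rewrite ![a * _]mulnC ![_ + _ * a]addnC !modnMDl.
  by rewrite !residue_min_mod; apply: coprime_mul_inj.
have size_ns : size ns + g = a * M.
  have gB : g = \sum_(j < a) residue_min j %/ a.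
    by have := residue_min_sum; rewrite -gE; lia.
  rewrite size_allpairs_dep sumnE big_map (_ : iota 0 a = index_iota 0 a); last first.
    by rewrite /index_iota subn0.
  under eq_bigr => j _ do rewrite size_iota.
  rewrite big_mkord gB -big_split /= -[in RHS](card_ord a) -sum_nat_const.
  by apply: eq_bigr => j _; rewrite subnK // min_le.
suff : size (k :: ns) + g <= a * M by rewrite /= addSn size_ns ltnn.
have N0_le : N0 <= a * M by apply: leq_trans (leq_pmull M a_gt0); rewrite /M; lia.
apply: hN0 => //.
- rewrite /=; apply/andP; split.
    apply/negP => /allpairsPdep [i' [j [+ _ kE]]].
    rewrite mem_iota add0n => /andP [_ i'a].
    have : i' = i.
      apply: (coprime_mul_inj cop_b) => //; rewrite ik kE -residue_min_mod.
      by rewrite addnC mulnC modnMDl.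
    by move=> e; move: k_lt; rewrite kE e; lia.
  apply: allpairs_uniq_dep => [|j _|]; [exact: iota_uniq | exact: iota_uniq |].
  move=> [i1 j1] [i2 j2] /allpairsPdep [i1' [j1' [+ _ [-> ->]]]].
  move=> + /allpairsPdep [i2' [j2' [+ _ [-> ->]]]].
  rewrite !mem_iota !add0n /= => h1 h2 e; have e12 := same _ _ _ _ h1 h2 e.
  subst i2'; move/eqP: e; rewrite eqn_add2l eqn_pmul2l // => /eqP -> //.
move=> m; rewrite inE => /predU1P [->|]; first by split=> //; apply: leq_trans (leq_pmull M a_gt0); rewrite /M; lia.
move=> /allpairsPdep [i' [j [+ + ->]]]; rewrite !mem_iota !add0n /= => i'a j_lt.
split; first exact/SW/residue_min_mem.
have lt_M : residue_min i' %/ a + j < M by lia.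
have : (residue_min i' %/ a + j).+1 * a <= M * a by rewrite leq_mul2r lt_M orbT.
rewrite {2}(divn_eq (residue_min i') a); have := ltn_pmod (residue_min i') a_gt0.
lia.
Qed.

End Counting.

(** * Coordinates on the plane model *)

Section Assembly.
Local Open Scope ring_scope.
Local Open Scope classical_set_scope.
Variables (R : realType) (X : curve R) (g : nat).
Hypothesis genus_X : has_genus X g.
Implicit Types (p P Q : cpoint X) (f h : X).

Lemma WS_add p m m' : WS p m -> WS p m' -> WS p (m + m')%N.
Proof.
move=> /(WS_P genus_X p) [f [f0 fL fp]] /(WS_P genus_X p) [f' [f'0 f'L f'p]].
apply/(WS_P genus_X p); exists (f * f'); split; first by rewrite mulf_neq0.
  apply: rr_space_le (rr_spaceM fL f'L) => q.
  by rewrite coeffD /mpt !coeff_point; case: ifP.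
by rewrite (valM (ord_valuation p)) // fp f'p; lia.
Qed.

Lemma WS_semigroup2 p a b : WS p a -> WS p b -> semigroup2 a b `<=` WS p.
Proof.
move=> pa pb k [i [j ->]].
have mul m i' : WS p m -> WS p (i' * m)%N.
  by move=> pm; elim: i' => [|i' IH]; [left | rewrite mulSn; apply: WS_add].
by apply: WS_add; apply: mul.
Qed.

(** After removing the leading term at P the pole order is a non-gap below a, hence 0, and the rest
    is constant. *)
Lemma rr_space_first_nongap P (a : nat) y f :
  (forall m : nat, WS P m -> (0 < m)%N -> (a <= m)%N) ->
  y != 0 -> ord P y = - a%:Z -> rr_space (mpt a P) y -> rr_space (mpt a P) f ->
  exists c c', f = cst X c + cst X c' * y.
Proof.
move=> first y0 yP yL fL.
have [c' hc'] : exists c', vge (ord P) (- a%:Z + 1) (f - cst X c' * y).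
  apply: vge_lead => //; move/rr_spaceP: fL => /(_ P).
  by rewrite /mpt coeff_point eqxx.
have hL : rr_space (mpt a P) (f - cst X c' * y).
  by apply: rr_spaceB => //; apply: rr_space_scale.
suff [c hc] : exists c, f - cst X c' * y = cst X c.
  by exists c, c'; rewrite -hc subrK.
move: (f - _) hc' hL => h hP hL.
have [->|h0] := eqVneq h 0; first by exists 0; rewrite rmorph0.
rewrite vge_neq0 // in hP.
have off p : p != P -> 0 <= ord p h.
  move=> pP; move/rr_spaceP: hL => /(_ p).
  by rewrite /mpt coeff_point eq_sym (negbTE pP) oppr0 vge_neq0.
have [ge0|lt0] := leP 0 (ord P h).
  apply: (rr_space_constant genus_X P); right=> p; rewrite coeff0 add0r.
  by have [->//|/off] := eqVneq p P.
have : WS P `|ord P h|%N.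
  apply/(WS_P genus_X P); exists h; split=> //; last by lia.
  right=> p; rewrite /mpt coeff_point; have [<-|Pp] := eqVneq P p; first by lia.
  by rewrite add0r off // eq_sym.
by move/first => /(_ ltac:(lia)); lia.
Qed.

Lemma is_basis_change (V : X -> Prop) (k : nat) (s u : 'I_k -> X) :
  is_basis V s -> is_basis V u ->
  exists E E' : 'M[R[i]]_k, [/\ forall i, s i = \sum_j u j * cst X (E j i),
    forall i, u i = \sum_j s j * cst X (E' j i), E *m E' = 1%:M & E' *m E = 1%:M].
Proof.
move=> bs bu.
have coord (w w' : 'I_k -> X) : is_basis V w -> is_basis V w' ->
    exists A : 'M[R[i]]_k, forall i, w i = \sum_j w' j * cst X (A j i).
  move=> bw [span _].
  have [c hc] := choice (fun i => (span (w i)).1 (is_basis_mem i bw)).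
  exists (\matrix_(j, i) c i j) => i; rewrite hc.
  by apply: eq_bigr => j _; rewrite mxE mulrC.
have inverse (w w' : 'I_k -> X) (A B : 'M[R[i]]_k) : is_basis V w ->
    (forall i, w i = \sum_j w' j * cst X (A j i)) ->
    (forall i, w' i = \sum_j w j * cst X (B j i)) -> B *m A = 1%:M.
  move=> [_ indep] wA wB; apply/matrixP => j i.
  pose d j := (B *m A) j i - (1%:M : 'M[R[i]]_k) j i.
  apply/eqP; rewrite -subr_eq0 -/(d j); apply/eqP; move: j.
  apply: indep; under eq_bigr => j _ do rewrite rmorphB mulrBl.
  rewrite sumrB (bigD1 i (F := fun j => cst X ((1%:M : 'M[R[i]]_k) j i) * w j)) //=.
  rewrite mxE eqxx rmorph1 mul1r [X in _ - (_ + X)]big1 => [|j /negbTE ji]; last first.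
    by rewrite mxE ji rmorph0 mul0r.
  rewrite addr0; apply/eqP; rewrite subr_eq0 [X in _ == X]wA; apply/eqP.
  under [RHS]eq_bigr => l _ do rewrite wB mulr_suml.
  rewrite exchange_big; apply: eq_bigr => j _ /=.
  rewrite mxE rmorph_sum mulr_suml; apply: eq_bigr => l _.
  by rewrite rmorphM mulrC mulrA.
have [E sE] := coord _ _ bs bu; have [E' uE] := coord _ _ bu bs.
exists E, E'; split=> //; [exact: inverse bu uE sE | exact: inverse bs sE uE].
Qed.

Lemma has_valueP p f c : has_value p f c -> vge (ord p) 1 (f - cst X c).
Proof.
case=> [->|h]; first by rewrite subrr vge0.
by apply/orP; right; rewrite -gtz0_ge1.
Qed.

(** In the coordinates u the point [p] goes to the coordinate point j0, because [u j0] has strictly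
    least order there. In the coordinates s this point is row j0 of E. *)
Lemma maps_to_row (s u : 'I_3 -> X) (E E' : 'M[R[i]]_3) p (x : proj R 2) j0 :
  (forall i, s i = \sum_j u j * cst X (E j i)) -> E *m E' = 1%:M ->
  u j0 != 0 -> (forall j, j != j0 -> vge (ord p) (ord p (u j0) + 1) (u j)) ->
  maps_to s p x ->
  exists2 c, c != 0 & forall i, E j0 i = c * crd x i.
Proof.
move=> sE EE' u0 u_gt [t t0 st].
have val_p := ord_valuation p.
have row i : vge (ord p) 1 (s i / u j0 - cst X (E j0 i)).
  rewrite sE mulr_suml (bigD1 j0) //= [u j0 * _]mulrC mulfK // addrAC subrr add0r.
  apply: (vge_sum val_p) => j jj0; rewrite mulrAC mulrC; apply: vge_scale.
  have -> : (1 : int) = (ord p (u j0) + 1) + - ord p (u j0) by rewrite addrAC subrr add0r.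
  apply: vgeM => //; first exact: u_gt.
  by rewrite vge_neq0 ?invr_neq0 // valV.
(* The two normalizations t and [u j0] both give finite, not all zero values at [p], so their
   quotient is a unit; its value is c. *)
pose rho := t / u j0.
have rho0 : rho != 0 by rewrite mulf_neq0 ?invr_neq0.
have srho i : s i / u j0 = s i / t * rho by rewrite /rho mulrA divfK.
have value_unit f c : c != 0 -> vge (ord p) 1 (f - cst X c) -> f != 0 /\ ord p f = 0.
  move=> c0 hf; have c0' : cst X c != 0 by rewrite fmorph_eq0.
  have : vge (ord p) (ord p (cst X c) + 1) (f - cst X c) by rewrite ord_cst.
  by move/(valD val_p c0'); rewrite addrC subrK ord_cst.
have value_ge0 f c : vge (ord p) 1 (f - cst X c) -> vge (ord p) 0 f.
  move=> hf; rewrite -(subrK (cst X c) f); apply: vgeD => //.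
    by apply: vge_le hf.
  exact: vge_cst.
have [i0 xi0] : exists i, crd x i = 1.
  by have /existsP [i /andP [/eqP xi _]] : normalized (val x) := valP x; exists i.
have [i1 Ei1] : exists i, E j0 i != 0.
  apply: contrapT => none; have := congr1 (fun A : 'M_3 => A j0 j0) EE'.
  rewrite !mxE eqxx big1 => [/eqP|i _]; first by rewrite eq_sym oner_eq0.
  have [->|Ei] := eqVneq (E j0 i) 0; first by rewrite mul0r.
  by case: none; exists i.
have rho_ge : 0 <= ord p rho.
  have x0 : crd x i0 != 0 by rewrite xi0 oner_neq0.
  have [w0 ord_w] := value_unit _ _ x0 (has_valueP (st i0)).
  have wrho0 : s i0 / t * rho != 0 by rewrite mulf_neq0.
  have := value_ge0 _ _ (row i0).
  by rewrite srho (vge_neq0 _ _ wrho0) (valM val_p) // ord_w add0r.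
have rho_le : ord p rho <= 0.
  have [s0 ord_s] := value_unit _ _ Ei1 (row i1).
  have := value_ge0 _ _ (has_valueP (st i1)).
  have w1 : s i1 / t != 0 by apply: contraNneq s0; rewrite srho => ->; rewrite mul0r.
  rewrite (vge_neq0 _ _ w1); move: ord_s; rewrite srho (valM val_p) //.
  by move: (ord p (s i1 / t)) (ord p rho) => o1 o2; lia.
have [c hc] : exists c, vge (ord p) 1 (rho - cst X c).
  by apply: vge_value; apply/orP; right.
have cE i : E j0 i = c * crd x i.
  apply/eqP; rewrite -subr_eq0; apply: contraT => ne.
  have := ord_cst p ne; suff : vge (ord p) 1 (cst X (E j0 i - c * crd x i)).
    by rewrite vge_neq0 ?fmorph_eq0 // => + e; rewrite e.
  have -> : cst X (E j0 i - c * crd x i) =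
      (s i / t - cst X (crd x i)) * rho + cst X (crd x i) * (rho - cst X c)
      - (s i / u j0 - cst X (E j0 i)).
    by rewrite srho rmorphB rmorphM /=; ring.
  apply: (vgeB val_p) => //; apply: (vgeD val_p); last exact: vge_scale.
  rewrite -[1]addr0; apply: (vgeM val_p); first exact: has_valueP.
  by rewrite vge_neq0.
exists c => //; apply: contraNneq Ei1 => c0; by rewrite cE c0 mul0r.
Qed.

(** The multiplicity is d minus the largest exponent of X_j0. Scaling E by 1/c makes row j0 equal to
    x and multiplies the form by a nonzero constant only. *)
Lemma multiplicity_support (F : {mpoly R[i][3]}) (d nu : nat) (E E' : 'M[R[i]]_3)
    (x : proj R 2) j0 c :
  F \is d.-homog -> E *m E' = 1%:M -> E' *m E = 1%:M -> c != 0 ->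
  (forall i, E j0 i = c * crd x i) -> multiplicity F x nu ->
  (forall m, m \in msupp (lin_subst E F) -> (nu + m j0 <= d)%N) /\
  exists2 m, m \in msupp (lin_subst E F) & (d <= nu + m j0)%N.
Proof.
move=> F_homog EE' E'E c0 Ex [F_van [m1 dm1 Fm1]].
have char0 : [pchar R[i]] =i pred0 by exact: pchar_num.
pose F1 := lin_subst (c^-1 *: E) F.
have F1_homog : F1 \is d.-homog by exact: dhomog_lin_subst.
have supp m : (m \in msupp F1) = (m \in msupp (lin_subst E F)).
  rewrite /F1 (lin_subst_scale _ _ F_homog) !mcoeff_msupp mcoeffZ mulf_eq0.
  by rewrite expf_eq0 invr_eq0 (negbTE c0) andbF.
have E1x i : (c^-1 *: E) j0 i = crd x i by rewrite mxE Ex mulKf.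
have E1K : (c *: E') *m (c^-1 *: E) = 1%:M.
  by rewrite -scalemxAl -scalemxAr scalerA divff // scale1r.
split=> [m|].
  rewrite -supp; apply: (vanish_unit_vec _ _ char0 F1_homog).1.
  apply: vanish_lin_subst; rewrite (_ : (fun i => _) = crd x) //.
  apply/funext => l; rewrite (bigD1 j0) //= big1 => [|j /negbTE jj0].
    by rewrite /unit_vec eqxx mul1r addr0.
  by rewrite /unit_vec jj0 mul0r.
apply: contrapT => none; case/eqP: Fm1.
suff : vanish nu.+1 (crd x) F by apply; rewrite dm1.
rewrite -(lin_substK E1K F) -/F1; apply: vanish_lin_subst.
rewrite (_ : (fun i => _) = unit_vec _ j0).
  apply/(vanish_unit_vec _ _ char0 F1_homog) => m m_in.
  rewrite addSn ltnNge; apply/negP => le; apply: none.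
  by exists m; [rewrite -supp | rewrite -ltnS].
apply/funext => l; have := congr1 (fun A : 'M_3 => A j0 l) EE'.
rewrite !mxE eq_sym => e; rewrite /unit_vec -e.
by apply: eq_bigr => j _; rewrite Ex mxE mulrCA mulrA.
Qed.

End Assembly.

(** * Multiplicities of the plane model at the images of [Q] and [P] *)

Section PlaneModel.
Local Open Scope ring_scope.
Local Open Scope classical_set_scope.
Variables (R : realType) (X : curve R) (g : nat).
Hypothesis genus_X : has_genus X g.
Variables (P : cpoint X) (a b : nat).
Hypotheses (a_gt0 : (0 < a)%N) (ab : (a < b)%N) (cop : coprime a b).
Hypothesis a_first : forall m : nat, WS P m -> (0 < m)%N -> (a <= m)%N.
Variables (D : divisor X) (s : 'I_3 -> X) (h : X) (F : {mpoly R[i][3]}).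
Hypotheses (effD : effective D) (DP : coeff P D = 0).
Hypotheses (div_h : differ_by_div (mpt b P) D h) (basis_s : is_basis (net_space P a h) s).
Hypothesis equation : plane_equation s F.

Let o0 : 'I_3 := ord0.
Let o1 : 'I_3 := Ordinal (isT : 1 < 3)%N.
Let o2 : 'I_3 := Ordinal (isT : 2 < 3)%N.

Definition triple (u0 u1 u2 : X) : 'I_3 -> X := fun i => nth u0 [:: u0; u1; u2] i.

Lemma net_function_neq0 : h != 0.
Proof. by case: div_h. Qed.

Lemma ord_net_function : ord P h = - b%:Z.
Proof. by case: div_h => _ /(_ P); rewrite DP /mpt coeff_point eqxx; lia. Qed.

Lemma ord_net_function_ge0 p : p != P -> 0 <= ord p h.
Proof.
move=> pP; case: div_h => _ /(_ p).
by rewrite /mpt coeff_point eq_sym (negbTE pP) add0r => <-; apply: effD.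
Qed.

Lemma ord_subr_cst be : h - cst X be != 0 /\ ord P (h - cst X be) = - b%:Z.
Proof.
rewrite -ord_net_function; apply: (valD (ord_valuation P)); first exact: net_function_neq0.
rewrite (vgeN (ord_valuation P)); apply: vge_le (vge_cst P be).
by rewrite ord_net_function; lia.
Qed.

Lemma vge_subr_cst be p : p != P -> vge (ord p) 0 (h - cst X be).
Proof.
move=> pP; apply: (vgeB (ord_valuation p)); last exact: vge_cst.
by rewrite vge_neq0 ?net_function_neq0 ?ord_net_function_ge0.
Qed.

Lemma rr_space_subr_cst be : rr_space (mpt b P) (h - cst X be).
Proof.
apply/rr_spaceP => p; rewrite /mpt coeff_point.
have [<-|Pp] := eqVneq P p; last by rewrite oppr0 vge_subr_cst // eq_sym.
apply: (vgeB (ord_valuation P)); first by rewrite vge_neq0 ?net_function_neq0 // ord_net_function.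
by apply: vge_le (vge_cst P be); lia.
Qed.

Section Coordinates.
Variable y : X.
Hypotheses (y0 : y != 0) (yP : ord P y = - a%:Z) (yL : rr_space (mpt a P) y).

Lemma is_basis_triple be : is_basis (net_space P a h) (triple 1 y (h - cst X be)).
Proof.
have [t0 tP] := ord_subr_cst be.
split=> [f|].
  split=> [[f0 [c [f0L ->]]]|[c ->]].
    have [c1 [c2 ->]] := rr_space_first_nongap genus_X a_first y0 yP yL f0L.
    exists (fun i : 'I_3 => nth 0 [:: c1 + c * be; c2; c] i).
    by rewrite ord3_sum /triple /= rmorphD rmorphM /=; ring.
  exists (cst X (c o0 - c o2 * be) + cst X (c o1) * y), (c o2); split.
    rewrite -[X in rr_space _ X]opprK opprD; apply/rr_spaceP => p.
    rewrite (vgeN (ord_valuation p)); apply: (vgeB (ord_valuation p)).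
      rewrite (vgeN (ord_valuation p)); apply: vge_le (vge_cst p _).
      by rewrite /mpt coeff_point; case: ifP => // _; lia.
    by apply: vge_scale; move/rr_spaceP: yL.
  by rewrite ord3_sum /triple /= rmorphB rmorphM /=; ring.
apply: (lin_indep_distinct (p := P)) => [i|].
  case: i => [[|[|[|//]]]] ? //; exact: oner_neq0.
have ord_u (i : 'I_3) : ord P (triple 1 y (h - cst X be) i)
    = - (nth 0%N [:: 0; a; b]%N i)%:Z.
  case: i => [[|[|[|//]]]] ? //=.
  by rewrite /triple /= (val1 (ord_valuation P)).
move=> i j; rewrite !ord_u => /oppr_inj [].
by case: i j => [[|[|[|//]]]] ? [[|[|[|//]]]] ? //= e; apply: val_inj => //=; lia.
Qed.

Lemma exists_coordinates be j0 p (x : proj R 2) :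
  let u := triple 1 y (h - cst X be) in
  (forall j, j != j0 -> vge (ord p) (ord p (u j0) + 1) (u j)) ->
  maps_to s p x ->
  exists E E' : 'M[R[i]]_3, [/\ forall i, s i = \sum_j u j * cst X (E j i),
    forall i, u i = \sum_j s j * cst X (E' j i), E *m E' = 1%:M, E' *m E = 1%:M &
    exists2 c, c != 0 & forall i, E j0 i = c * crd x i].
Proof.
move=> u u_gt xs; have bu := is_basis_triple be.
have [E [E' [sE uE EE' E'E]]] := is_basis_change basis_s bu.
exists E, E'; split=> //; apply: maps_to_row sE EE' _ u_gt xs.
exact: is_basis_neq0 bu.
Qed.

End Coordinates.

Lemma exists_degree_bound (G : {poly {poly R[i]}}) :
  exists N : nat, forall i e, G`_i`_e != 0 -> (i + e <= N)%N.
Proof.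
exists (size G + \max_(i < size G) size (G`_i : {poly R[i]})%R)%N => i e Gie.
have lt_i : (i < size G)%N.
  rewrite ltnNge; apply/negP => le; move: Gie.
  by rewrite (_ : G`_i = 0) ?coef0 ?eqxx // nth_default.
have lt_e : (e < size (G`_i : {poly R[i]})%R)%N.
  rewrite ltnNge; apply/negP => le; move: Gie.
  by rewrite (_ : G`_i`_e = 0) ?eqxx // nth_default.
have := leq_bigmax (F := fun i : 'I_(size G) => size (G`_i : {poly R[i]})%R) (Ordinal lt_i).
by move=> le; apply: leq_add (ltnW lt_i) (leq_trans (ltnW lt_e) le).
Qed.

Lemma order_at_zero_of_pole_function Q y (x : proj R 2) (nu : nat) :
  P != Q -> y != 0 ->
  (forall p, coeff p (mpt a Q) = coeff p (mpt a P) + ord p y) ->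
  maps_to s Q x -> multiplicity F x nu -> (nu < a)%N ->
  exists be, ord Q (h - cst X be) = nu%:Z.
Proof.
move=> PQ y0 div_y sx mult_F nu_lt.
have QP : Q != P by rewrite eq_sym.
have [be hbe] : exists be, vge (ord Q) 1 (h - cst X be).
  by apply: vge_value; rewrite vge_neq0 ?net_function_neq0 // ord_net_function_ge0.
exists be; pose z := h - cst X be.
have [z0 zP] := ord_subr_cst be.
have z_ge1 : 1 <= ord Q z by move: hbe; rewrite (vge_neq0 _ _ z0).
have [k zk] : exists k : nat, ord Q z = k%:Z by exists `|ord Q z|%N; lia.
have k_gt0 : (0 < k)%N by lia.
have yP := ord_yP a_gt0 y0 PQ div_y; have yQ := ord_yQ PQ div_y.
have yL := rr_space_y_pole div_y.
(* At Q both y and z vanish, so the constant coordinate 1 has strictly least order. *)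
have [|E [E' [sE uE EE' E'E [c c0 Ec]]]] := exists_coordinates y0 yP yL (be := be) (j0 := o0) _ sx.
  rewrite /triple /= (val1 (ord_valuation Q)) add0r.
  case=> [[|[|[|//]]]] lt; rewrite -val_eqE //= => _.
  by rewrite vge_neq0 // yQ; lia.
have z_reg : regular_off P z by exists b; exact: rr_space_subr_cst.
have [G [G_monic size_G G_root G_newton Gk]] :=
  newton_polygon_zero genus_X a_gt0 cop y0 z0 yP zP PQ div_y z_reg zk k_gt0.
have [[d F_homog] _] := equation.
have [N hN] := exists_degree_bound G.
pose u := triple 1 y z.
have u0 : u o0 != 0 by rewrite /u /triple /= oner_neq0.
have uy : u o1 / u o0 = y by rewrite /u /triple /= divr1.
have uz : u o2 / u o0 = z by rewrite /u /triple /= divr1.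
have size_root q : q != 0 -> ev2 (cst X) (u o1 / u o0) (u o2 / u o0) q = 0 -> (a < size q)%N.
  by rewrite uy uz => q0 q_root; apply: (ev2_root_size a_gt0 cop y0 z0 yP zP q0 q_root).
have G_root' : ev2 (cst X) (u o1 / u o0) (u o2 / u o0) G = 0 by rewrite uy uz.
have [c' c'0 GE] := dehom_scalar equation F_homog sE uE EE' u0 hN G_root' G_monic size_G size_root.
have coefE i e : G`_i`_e = c' * (dehom (lin_subst E F))`_i`_e by rewrite GE !coefCM.
have [supp_ge [m m_in m_le]] := multiplicity_support F_homog EE' E'E c0 Ec mult_F.
have F'_homog := dhomog_lin_subst E F_homog.
have deg_m m' : m' \in msupp (lin_subst E F) -> d = (m' o0 + m' o1 + m' o2)%N.
  by move=> m'_in; rewrite -mdeg3; move/dhomogP: F'_homog => /(_ _ m'_in) <-.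
have nu_le : (nu <= k)%N.
  move: Gk; rewrite coefE mulf_eq0 negb_or => /andP [_ /coef_dehom_neq0].
  case=> m' m'_in [m'1 m'2]; have := supp_ge _ m'_in; have := deg_m _ m'_in.
  by rewrite m'1 m'2 => e le; clear -e le; lia.
have k_le : (k <= nu)%N.
  have m_newton : (a * k <= a * m o1 + k * m o2)%N.
    apply: G_newton; rewrite coefE mulf_neq0 //.
    by rewrite (coef_dehom_msupp F'_homog m_in) -mcoeff_msupp.
  have := deg_m _ m_in => dE.
  have m12 : (m o1 + m o2 <= nu)%N by clear -dE m_le; lia.
  (* If nu < k as well as nu < a, then a m1 + k m2 is at most max(a, k) nu, which is less than
     ak. *)
  rewrite leqNgt; apply/negP => lt; clear -m_newton m12 nu_lt lt.
  by case: (leqP k a) => ka; nia.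
by rewrite zk; congr Posz; apply/eqP; rewrite eqn_leq k_le nu_le.
Qed.

Lemma multiplicity_at_pole y (x : proj R 2) (nu : nat) :
  y != 0 -> ord P y = - a%:Z -> rr_space (mpt a P) y ->
  maps_to s P x -> multiplicity F x nu -> (nu + a = b)%N.
Proof.
move=> y0 yP yL sx mult_F.
pose z := h - cst X 0.
have [z0 zP] := ord_subr_cst 0.
have zL := rr_space_subr_cst 0.
(* At P the function z has the strictly largest pole, so now the last coordinate dominates. *)
have [|E [E' [sE uE EE' E'E [c c0 Ec]]]] := exists_coordinates y0 yP yL (be := 0) (j0 := o2) _ sx.
  rewrite /triple /= zP.
  case=> [[|[|[|//]]]] lt; rewrite -val_eqE //= => _.
    by rewrite vge_neq0 ?oner_neq0 // (val1 (ord_valuation P)); lia.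
  by rewrite vge_neq0 // yP; lia.
have b_gt0 : (0 < b)%N by lia.
have [G [G_monic size_G G_root G_newton Gb]] :=
  newton_polygon_pole genus_X a_gt0 cop y0 z0 yP zP yL zL b_gt0.
have [[d F_homog] _] := equation.
have hN i e : G`_i`_e != 0 -> (i + e <= b)%N.
  by move=> /G_newton le; clear -le ab a_gt0; nia.
pose u := triple 1 y z.
have u0 : u o0 != 0 by rewrite /u /triple /= oner_neq0.
have uy : u o1 / u o0 = y by rewrite /u /triple /= divr1.
have uz : u o2 / u o0 = z by rewrite /u /triple /= divr1.
have size_root q : q != 0 -> ev2 (cst X) (u o1 / u o0) (u o2 / u o0) q = 0 -> (a < size q)%N.
  by rewrite uy uz => q0 q_root; apply: (ev2_root_size a_gt0 cop y0 z0 yP zP q0 q_root).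
have G_root' : ev2 (cst X) (u o1 / u o0) (u o2 / u o0) G = 0 by rewrite uy uz.
have [c' c'0 GE] := dehom_scalar equation F_homog sE uE EE' u0 hN G_root' G_monic size_G size_root.
have d_le : (d <= b)%N.
  by apply: (degree_le equation F_homog uE EE' u0 hN G_root'); rewrite monic_neq0.
have coefE i e : G`_i`_e = c' * (dehom (lin_subst E F))`_i`_e by rewrite GE !coefCM.
have [supp_ge [m m_in m_le]] := multiplicity_support F_homog EE' E'E c0 Ec mult_F.
have F'_homog := dhomog_lin_subst E F_homog.
have deg_m m' : m' \in msupp (lin_subst E F) -> d = (m' o0 + m' o1 + m' o2)%N.
  by move=> m'_in; rewrite -mdeg3; move/dhomogP: F'_homog => /(_ _ m'_in) <-.
(* Homogenizing G in degree b gave d <= b; the monomial Y^b gives the converse. *)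
have d_eq : d = b.
  move: Gb; rewrite coefE mulf_eq0 negb_or => /andP [_ /coef_dehom_neq0].
  by case=> m' m'_in [m'1 m'2]; have := deg_m _ m'_in; rewrite m'1 m'2 => e; clear -e d_le; lia.
have Ga : G`_a`_0 != 0.
  by move/monicP: G_monic; rewrite lead_coefE size_G => ->; rewrite coef1 oner_neq0.
(* The exponent a of Z occurs since G is monic, and the Newton bound excludes larger ones. *)
have nu_le : (nu + a <= b)%N.
  move: Ga; rewrite coefE mulf_eq0 negb_or => /andP [_ /coef_dehom_neq0].
  by case=> m' m'_in [_ m'2]; have := supp_ge _ m'_in; rewrite m'2 d_eq.
have m2_le : (m o2 <= a)%N.
  have : G`_(m o2)`_(m o1) != 0.
    by rewrite coefE mulf_neq0 // (coef_dehom_msupp F'_homog m_in) -mcoeff_msupp.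
  move=> /G_newton le; clear -le ab; nia.
by clear -nu_le m2_le m_le d_eq; lia.
Qed.

End PlaneModel.

(** * Functions whose only pole is at [Q] *)

Section CuspSemigroup.
Local Open Scope ring_scope.
Local Open Scope classical_set_scope.
Variables (R : realType) (X : curve R) (g : nat).
Hypothesis genus_X : has_genus X g.

Lemma cusp_semigroup_sub (P Q : cpoint X) (a b n r : nat) (y z : X) :
  P != Q -> (0 < r < a)%N -> b = (n * a + r)%N -> y != 0 -> z != 0 ->
  (forall p, coeff p (mpt a Q) = coeff p (mpt a P) + ord p y) ->
  ord P z = - b%:Z -> (forall p, p != P -> 0 <= ord p z) ->
  ord Q z = (a - r)%N%:Z ->
  cusp_semigroup a b (a - r) `<=` WS Q.
Proof.
move=> PQ /andP [r_gt0 ra] bE y0 z0 div_y zP z_ge0 zQ.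
have a_gt0 : (0 < a)%N by exact: leq_trans ra.
have yP := ord_yP a_gt0 y0 PQ div_y; have yQ := ord_yQ PQ div_y.
have y_off p : p != P -> p != Q -> ord p y = 0.
  move=> pP pQ; move: (div_y p).
  rewrite /mpt !coeff_point eq_sym (negbTE pQ) eq_sym (negbTE pP) add0r => <- //.
have nongap (i m : nat) (k : nat) : (k + m * a = i * b)%N -> (m * a <= i * (a - r))%N ->
    WS Q k.
  move=> kE le; apply/(WS_P genus_X Q).
  (* As b = na + r, the quotient has a pole of order b at Q and a zero of order a - r at P. The
     factor y^m lowers both by ma, and ma <= i(a - r) keeps f regular at P. *)
  pose f := (z / y ^+ n.+1) ^+ i * y ^+ m.
  have w0 : z / y ^+ n.+1 != 0 by rewrite mulf_neq0 ?invr_neq0 ?expf_neq0.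
  have f0 : f != 0 by rewrite mulf_neq0 ?expf_neq0.
  have ord_f p : ord p f = (ord p z - ord p y * n.+1%:Z) * i%:Z + ord p y * m%:Z.
    have val_p := ord_valuation p.
    rewrite /f (valM val_p) ?expf_neq0 // !(valX val_p) // (valM val_p) ?invr_neq0 ?expf_neq0 //.
    rewrite (valV val_p) ?expf_neq0 // (valX val_p) //.
    by rewrite -[_ *+ n.+1]mulr_natr -[_ *+ i]mulr_natr -[_ *+ m]mulr_natr !natz.
  have fQ : ord Q f = - k%:Z by rewrite ord_f zQ yQ; clear -kE bE ra; nia.
  exists f; split=> //; right=> p; rewrite /mpt coeff_point.
  have [<-|Qp] := eqVneq Q p; first by rewrite fQ; clear; lia.
  rewrite add0r ord_f; have [->|pP] := eqVneq p P.
    by rewrite zP yP; clear -le bE ra; nia.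
  have pQ : p != Q by rewrite eq_sym.
  by rewrite (y_off p pP pQ) !mul0r subr0 addr0 mulr_ge0 ?z_ge0.
have bQ : WS Q b by apply: (nongap 1%N 0%N); rewrite ?mul0n ?addn0 ?mul1n.
have aQ : WS Q a.
  apply/(WS_P genus_X Q); exists y^-1; rewrite invr_neq0 //; split=> //.
    right=> p; rewrite (valV (ord_valuation p)) // div_y -addrA subrr addr0 /mpt coeff_point.
    by case: ifP.
  by rewrite (valV (ord_valuation Q)) // yQ.
move=> k [|[m [i [nm [m_bd nm_bd i_bd kE]]]]]; first by move/(WS_semigroup2 genus_X aQ bQ).
(* The bounds ma < n(m) mu and n(m) <= i give exactly the required ma <= i mu. *)
apply: nongap kE _; case/andP: nm_bd => _ /ltnW /leq_trans; apply.
by rewrite leq_mul2r; case/andP: i_bd => -> _; rewrite orbT.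
Qed.

End CuspSemigroup.

Unset Implicit Arguments.
Local Open Scope classical_set_scope.

Theorem corollary10 (R : realType) (C : curve R) (g : nat) (P : cpoint C)
    (a b n r : nat)
    (genus_C : has_genus C g)
    (a_nongap : WS P a) (a_gt0 : (0 < a)%N)
    (a_first : forall m : nat, WS P m -> (0 < m)%N -> (a <= m)%N)
    (b_nongap : WS P b) (b_nmul : ~~ (a %| b)%N)
    (b_first : forall m : nat, WS P m -> ~~ (a %| m)%N -> (b <= m)%N)
    (b_eq : b = (n * a + r)%N) (n_ge1 : (1 <= n)%N) (r_bounds : (0 < r < a)%N)
    (coprime_ab : coprime a b)
    (dim_hyp : has_dim_system (mpt ((n + 1) * a) P) (n + 2))
    (genus_eq : (2 * g)%N = ((a - 1) * (b - a + r))%N)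
    (D : divisor C) (s : 'I_3 -> C) (F : {mpoly R[i][3]})
    (model : plane_model P a b D s) (equation : plane_equation s F)
    (Q : cpoint C) (aQ : complete_system (mpt a P) (mpt a Q))
    (x : proj R 2) (phiQ : maps_to s Q x) (cusp : is_cusp s F x (a - r) a) :
  WS Q = semigroup2 a b `|` trivial_new_nongaps a b (a - r).
Proof.
have [[effD _] DP [h div_h basis_s]] := model.
have [_ mult_F _] := cusp.
have /andP [r_gt0 r_lt] := r_bounds.
have ab : (a < b)%N by rewrite b_eq; clear -n_ge1 r_gt0; nia.
have cop_r : coprime a r by move: coprime_ab; rewrite b_eq /coprime gcdnMDl.
have cop_mu : coprime a (a - r).
  rewrite /coprime gcdnC -[X in gcdn _ X](subnK (ltnW r_lt)) gcdnDl gcdnC.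
  by rewrite -(gcdnDl r) subnKC ?(ltnW r_lt) // gcdnC.
have mu_lt : (a - r < a)%N by clear -r_gt0 r_lt; lia.
apply: (cusp_semigroup_max a_gt0 coprime_ab cop_mu mu_lt _ (g := g)).
- by clear -ab; lia.
- by rewrite genus_eq; congr (_ * _)%N; clear -ab r_lt; lia.
- have [PQ|PQ] := eqVneq P Q.
    subst Q; have [y [y0 yL yP]] := (WS_P genus_C P P a).1 a_nongap.
    have := multiplicity_at_pole genus_C a_gt0 ab coprime_ab a_first effD DP div_h
      basis_s equation y0 yP yL phiQ mult_F.
    move=> nu_eq; rewrite b_eq in nu_eq.
    (* The multiplicity gives 2a = na + 2r. As r > 0, only n = 1 is possible, so a = 2r, and
       coprimality then leaves r = 1. *)
    have a2 : a = (2 * r)%N.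
      clear -nu_eq r_gt0 r_lt n_ge1.
      by case: n n_ge1 nu_eq => [|[|n']] // _; rewrite ?mul1n ?mulSn; lia.
    have r1 : r = 1%N.
      by apply/eqP; move: cop_r; rewrite a2 /coprime gcdnC gcdnMl.
    move=> k [|[m [i [nm [m_bd]]]]]; first exact: (WS_semigroup2 genus_C a_nongap b_nongap).
    by move: m_bd; rewrite a2 r1; clear; lia.
  have [_ [y [y0 div_y]]] := aQ.
  have nu_lt : (a - r < a)%N by [].
  have [be zQ] := order_at_zero_of_pole_function genus_C a_gt0 ab coprime_ab a_first
    effD DP div_h basis_s equation PQ y0 div_y phiQ mult_F nu_lt.
  have [z0 zP] := ord_subr_cst a_gt0 ab coprime_ab DP div_h be.
  apply: (cusp_semigroup_sub genus_C PQ r_bounds b_eq y0 z0 div_y zP _ zQ) => p pP.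
  by have := vge_subr_cst effD div_h be pP; rewrite vge_neq0.
exact: nongap_count.
Qed.
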